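(* Let $(a_n)_{n\in\mathbb N}$ be a sequence of positive integers such that: (a) $(a_n)_{n\in\mathbb N}$ is bounded; (b) there is $\alpha>0$ such that $|\{1\leqslant n\leqslant m: a_n\geqslant 2\}|\leqslant\alpha m^{1/4}$ for all $m\in\mathbb N$; (c) the set $\{n\in\mathbb N: a_n\geqslant 2\}$ is infinite. Then the $\mathcal F_{(a_n)}$-minimum partially greedy property lies strictly between strong partial greediness and almost greediness, that is: every almost greedy basis is $\mathcal F_{(a_n)}$-minimum partially greedy; every $\mathcal F_{(a_n)}$-minimum partially greedy basis is strong partially greedy; there exists an $\mathcal F_{(a_n)}$-minimum partially greedy basis that is not almost greedy; and there exists a strong partially greedy basis that is not $\mathcal F_{(a_n)}$-minimum partially greedy. (Here ''basis'' means a basis of a $p$-Banach space, $0<p\leqslant 1$.)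
   Context: Let $\mathbb N=\{1,2,\dots\}$ and let $\mathbb N^{<\infty}$ be the collection of finite subsets of $\mathbb N$. A $p$-Banach space ($0<p\leqslant 1$) over $\mathbb F$ ($=\mathbb R$ or $\mathbb C$) is a vector space complete under a homogeneous, positive definite $\|\cdot\|$ with $\|x+y\|^p\leqslant\|x\|^p+\|y\|^p$. All spaces $X$ are separable and infinite dimensional; $X^*$ is the dual of $X$. A basis $\mathcal B$ of $X$ is a sequence $(e_n)_{n=1}^\infty\subset X$ whose span is dense in $X$, for which there is a unique sequence $(e_n^* )_n\subset X^*$ with $e_m^*(e_n)=\delta_{m,n}$ for all $m,n$, and such that $0<\inf_n\{\|e_n\|,\|e_n^*\|\}\leqslant\sup_n\{\|e_n\|,\|e_n^*\|\}<\infty$. For $A\in\mathbb N^{<\infty}$, $P_A(x)=\sum_{n\in A}e_n^*(x)e_n$; for $k\geqslant 0$, $S_k(x)=\sum_{n=1}^k e_n^*(x)e_n$. For $x\in X$ and an integer $m\geqslant 0$, $\Lambda_m(x)$ denotes any set with $|\Lambda_m(x)|=m$ and $\min_{n\in\Lambda_m(x)}|e_n^*(x)|\geqslant\max_{n\notin\Lambda_m(x)}|e_n^*(x)|$ (the choice need not be unique; $\Lambda_0(x)=\emptyset$). A basis is almost greedy if there is $C>0$ such that $\|x-P_{\Lambda_m(x)}(x)\|\leqslant C\inf\{\|x-P_A(x)\|: A\subset\mathbb N,\ |A|=m\}$ for all $x\in X$, $m\in\mathbb N$ and all choices of $\Lambda_m(x)$. A basis is strong partially greedy if there is $C>0$ such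 that $\|x-P_{\Lambda_m(x)}(x)\|\leqslant C\inf_{0\leqslant k\leqslant m}\|x-S_k(x)\|$ for all $x\in X$, $m\in\mathbb N$ and all choices of $\Lambda_m(x)$. For a collection $\mathcal F$ of finite subsets of $\mathbb N$ with $\emptyset\in\mathcal F$, a basis is $\mathcal F$-minimum partially greedy if there is $\Delta\geqslant 1$ such that for all $x\in X$, $m\in\mathbb N$ and all choices of $\Lambda_m(x)$, $\|x-P_{\Lambda_m(x)}(x)\|\leqslant\Delta\inf\|x-P_F(x)\|$, the infimum being over all $F\in\mathcal F$ with $|F|\leqslant m$ such that either $F=\emptyset$ or $\min F\leqslant n$ for all $n\in\Lambda_m(x)$. $\mathcal F_{(a_n)}:=\{\emptyset\}\cup\{k+\{a_1,a_1+a_2,\dots,a_1+a_2+\cdots+a_\ell\}: k\geqslant 0,\ \ell\geqslant 1\}$ ($k,\ell$ integers), where $k+A=\{k+n:n\in A\}$. *)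

(* Defs.v *)
(* Indexing convention: the positive integers are represented by [nat], the
   natural number [n] standing for the position [n.+1].  Thus [B n], [coef B n]
   and [a n] below stand for e_(n+1), e*_(n+1) and a_(n+1), and a finite set
   of positions is an [{fset nat}].  Cardinalities [m], numbers of summands [k]
   and shifts [k] are ordinary natural numbers and are not shifted. *)
From HB Require Import structures.
From mathcomp Require Import all_boot all_order all_algebra finmap.
From mathcomp Require Import all_classical all_reals all_analysis.
From mathcomp Require Import complex.
Set Implicit Arguments.
Unset Strict Implicit.
Unset Printing Implicit Defensive.
Import Order.TTheory GRing.Theory Num.Theory.
Import numFieldNormedType.Exports.
Local Open Scope classical_set_scope.
Local Open Scope fset_scope.
Local Open Scope ring_scope.

Inductive scalar_kind := RealScalars | ComplexScalars.

Definition scalar_field (R : realType) (F : scalar_kind) : numFieldType :=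
  match F with
  | RealScalars => R : numFieldType
  | ComplexScalars => R[i] : numFieldType
  end.

(* In MathComp the norm of a complex number is itself a complex number;
   [modulus] is the absolute value as an element of [R]. *)
Definition modulus (R : realType) (F : scalar_kind) : scalar_field R F -> R :=
  match F with
  | RealScalars => fun z : R => `|z|
  | ComplexScalars => fun z : R[i] => ComplexField.Normc.normc z
  end.

Section Norm.
Variables (R : realType) (F : scalar_kind) (X : lmodType (scalar_field R F)).
Variable N : X -> R.

Definition converges_to (u : nat -> X) (l : X) : Prop :=
  (fun n => N (u n - l)) @ \oo --> (0 : R).

Definition cauchy_seq (u : nat -> X) : Prop :=
  forall eps : R, 0 < eps -> exists M : nat,
    forall m n : nat, (M <= m)%N -> (M <= n)%N -> N (u m - u n) < eps.

Definition dense_set (D : set X) : Prop :=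
  forall (x : X) (eps : R), 0 < eps -> exists2 y, D y & N (x - y) < eps.

Definition separable_space : Prop :=
  exists2 D : set X, countable D & dense_set D.

End Norm.

Definition linear_span (R : realType) (F : scalar_kind)
    (X : lmodType (scalar_field R F)) (e : nat -> X) : set X :=
  [set x | exists (n : nat) (c : nat -> scalar_field R F),
             x = \sum_(i < n) c i *: e i].

Definition infinite_dimensional (R : realType) (F : scalar_kind)
    (X : lmodType (scalar_field R F)) : Prop :=
  forall (n : nat) (v : 'I_n -> X),
    exists x : X, forall c : 'I_n -> scalar_field R F, x <> \sum_(i < n) c i *: v i.

Record pBanach (R : realType) (F : scalar_kind) (p : R) := PBanach {
  carrier :> lmodType (scalar_field R F);
  qnorm : carrier -> R;
  qnorm_ge0 : forall x, 0 <= qnorm x;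
  qnorm_definite : forall x, qnorm x = 0 -> x = 0;
  qnorm_homogeneous : forall (c : scalar_field R F) (x : carrier),
    qnorm (c *: x) = modulus c * qnorm x;
  qnorm_ptriangle : forall x y : carrier,
    qnorm (x + y) `^ p <= qnorm x `^ p + qnorm y `^ p;
  qnorm_complete : forall u : nat -> carrier,
    cauchy_seq qnorm u -> exists l, converges_to qnorm u l;
  qnorm_separable : separable_space qnorm;
  carrier_infinite_dimensional : infinite_dimensional carrier
}.

Section Basis.
Variables (R : realType) (F : scalar_kind) (p : R) (X : pBanach F p).

Definition dual_norm (f : {scalar X}) : \bar R :=
  ereal_sup [set (modulus (f x))%:E | x in [set x : X | qnorm x <= 1]].

Definition in_dual (f : {scalar X}) : Prop := (dual_norm f < +oo)%E.

Definition biorthogonal (e : nat -> X) (f : nat -> {scalar X}) : Prop :=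
  forall m n : nat, f m (e n) = (m == n)%:R.

Definition norm_values (e : nat -> X) (f : nat -> {scalar X}) : set (\bar R) :=
  range (fun n => (qnorm (e n))%:E) `|` range (fun n => dual_norm (f n)).

Record pbasis := PBasis {
  bvec :> nat -> X;
  coef : nat -> {scalar X};
  bvec_span_dense : dense_set (@qnorm R F p X) (linear_span bvec);
  coef_dual : forall n, in_dual (coef n);
  coef_biorthogonal : biorthogonal bvec coef;
  coef_unique : forall f : nat -> {scalar X}, (forall n, in_dual (f n)) ->
    biorthogonal bvec f -> forall n, f n =1 coef n;
  bvec_coef_bounded_below : (0 < ereal_inf (norm_values bvec coef))%E;
  bvec_coef_bounded : (ereal_sup (norm_values bvec coef) < +oo)%E
}.

Variable B : pbasis.

Definition coord_proj (A : {fset nat}) (x : X) : X :=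
  \sum_(n <- A) coef B n x *: B n.

Definition partial_sum (k : nat) (x : X) : X :=
  \sum_(n < k) coef B n x *: B n.

(* [L] is one of the admissible choices of the greedy set of order [m]. *)
Definition greedy_set (x : X) (m : nat) (L : {fset nat}) : Prop :=
  #|` L| = m /\
  forall i j : nat, i \in L -> j \notin L ->
    modulus (coef B j x) <= modulus (coef B i x).

Definition almost_greedy : Prop :=
  exists2 C : R, 0 < C &
    forall (x : X) (m : nat) (L : {fset nat}), (0 < m)%N ->
      greedy_set x m L ->
      qnorm (x - coord_proj L x) <=
        C * inf [set qnorm (x - coord_proj A x) | A in [set A | #|` A| = m]].

Definition strong_partially_greedy : Prop :=
  exists2 C : R, 0 < C &
    forall (x : X) (m : nat) (L : {fset nat}), (0 < m)%N ->
      greedy_set x m L ->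
      qnorm (x - coord_proj L x) <=
        C * inf [set qnorm (x - partial_sum k x) | k in [set k | (k <= m)%N]].

Definition fset_minimum (A : {fset nat}) (i : nat) : Prop :=
  i \in A /\ forall j, j \in A -> (i <= j)%N.

Definition min_before (A L : {fset nat}) : Prop :=
  A = fset0 \/
  exists2 i, fset_minimum A i & forall n, n \in L -> (i <= n)%N.

(* Meant for collections [FF] containing the empty set, so that the set whose
   infimum is taken is nonempty. *)
Definition minimum_partially_greedy (FF : set {fset nat}) : Prop :=
  exists2 Delta : R, 1 <= Delta &
    forall (x : X) (m : nat) (L : {fset nat}), (0 < m)%N ->
      greedy_set x m L ->
      qnorm (x - coord_proj L x) <=
        Delta * inf [set qnorm (x - coord_proj A x) | A in
          [set A | [/\ FF A, (#|` A| <= m)%N & min_before A L]]].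

End Basis.

(* The element k + a_1 + ... + a_(j+1), as a position, is represented by its
   predecessor; this loses nothing when the terms of [a] are positive. *)
Definition shifted_sums (a : nat -> nat) (k l : nat) : {fset nat} :=
  [fset (k + \sum_(i < j.+1) a i).-1%N | j in iota 0 l].

Definition seq_family (a : nat -> nat) : set {fset nat} :=
  [set A | A = fset0 \/
           exists k l : nat, (0 < l)%N /\ A = shifted_sums a k l].

(* Main.v *)
Require Import Defs.
From HB Require Import structures.
From mathcomp Require Import all_boot all_order all_algebra finmap.
From mathcomp Require Import all_classical all_reals all_analysis.
From mathcomp Require Import complex.
From mathcomp Require Import zify ring.
Set Implicit Arguments.
Unset Strict Implicit.
Unset Printing Implicit Defensive.
Import Order.TTheory GRing.Theory Num.Theory.
Import numFieldNormedType.Exports.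
Local Open Scope classical_set_scope.
Local Open Scope ring_scope.

(** The first two implications hold for every basis. If the basis is almost
    greedy, a competitor with fewer than [m] elements can be padded with far away
    positions, where the coefficients of [x] are negligible
    ([almost_greedy_minimum_partially_greedy]). If it is minimum partially greedy,
    let [y0] be the tail [x - S_k x]. The error of a greedy step on [x] is the error
    of a greedy step on [y0], controlled by the empty competitor, plus the head
    coefficients missed by the greedy set. As the terms of [a] are bounded by [M],
    the head is covered, up to finitely many positions, by [M] members of the
    family lying inside it ([seq_family_cover]). On each of them the missed
    coefficients are recovered by filling the rest of the member with a value as
    large as the smallest tail coefficient: removing the whole member leaves [y0],
    while the greedy residual retains the missed coefficients
    ([head_piece_bound]).

    Both separating examples are unit vector bases of Schreier-type spaces, with
    norm the supremum of the sums of moduli over sets [A] such that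
    [#|A| <= phi (min A)]; only the nondecreasing unbounded gauge [phi] differs.
    All of them are strong partially greedy, since sets further to the right have
    larger norm ([schreier_strong_partially_greedy]). An initial segment of length
    [n] has norm at most [phi n], whereas distant sets of size [n] have norm [n], so
    the basis is not almost greedy if [phi n] is much smaller than [n].

    What distinguishes minimum partial greediness is that the greedy set may sit
    in the gaps between the partial sums of [a] instead of lying beyond the
    competitor. Let [gap_count a n] be the number of gaps up to [n]. If [phi]
    exceeds the gap count, then a set of gaps has an admissible half and thus a norm
    proportional to its size, the largest possible, so the basis is minimum
    partially greedy ([charge_to_complement]); sparseness of the terms exceeding 1
    makes the gap count sublinear, so it is not almost greedy. If instead [phi] is
    the logarithm of the gap count, which is unbounded because infinitely many terms
    exceed 1, then the indicator of all gaps up to [n] is far smaller than that of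
    equally many distant partial sums
    ([schreier_not_minimum_partially_greedy]). *)

(** * Scalars *)

Section Scalars.
Variables (R : realType) (F : scalar_kind).
Implicit Types z w : scalar_field R F.

Lemma modulus_ge0 z : 0 <= modulus z.
Proof. by case: F z => [z|[u v]] /=; rewrite ?normr_ge0 ?sqrtr_ge0. Qed.

Lemma modulus0 : modulus (0 : scalar_field R F) = 0.
Proof. by case: F => /=; [exact: normr0 | exact: ComplexField.Normc.normc0]. Qed.

Lemma modulus1 : modulus (1 : scalar_field R F) = 1.
Proof. by case: F => /=; [exact: normr1 | exact: ComplexField.Normc.normc1]. Qed.

Lemma modulusN z : modulus (- z) = modulus z.
Proof.
case: F z => [z|[u v]]; first exact: normrN.
by rewrite /= !sqrrN.
Qed.

Lemma modulus_eq0 z : modulus z = 0 -> z = 0.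
Proof. by case: F z => z; [exact: normr0_eq0 | exact: ComplexField.Normc.eq0_normc]. Qed.

Lemma modulusM z w : modulus (z * w) = modulus z * modulus w.
Proof. by case: F z w => z w; [exact: normrM | exact: ComplexField.Normc.normcM]. Qed.

Lemma modulusD z w : modulus (z + w) <= modulus z + modulus w.
Proof. by case: F z w => z w; [exact: ler_normD | exact: le_normcD]. Qed.

Lemma exists_scalar_of_modulus (r : R) : 0 <= r ->
  exists z : scalar_field R F, modulus z = r.
Proof.
move=> r0; case: F => /=; first by exists r; rewrite ger0_norm.
by exists r%:C%C; rewrite /= expr0n addr0 sqrtr_sqr ger0_norm.
Qed.

End Scalars.

Lemma real_cauchy_converges (R : realType) (u : nat -> R) :
  (forall eps, 0 < eps -> exists M, forall m n, (M <= m)%N -> (M <= n)%N ->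
     `|u m - u n| < eps) ->
  exists l, forall eps, 0 < eps -> exists M, forall n, (M <= n)%N ->
     `|u n - l| < eps.
Proof.
move=> uC.
have /cauchy_cvgP/cvg_ex[l /cvgrPdist_lt ul] : cauchy (u @ \oo).
  apply: cauchy_exP => e e0; have [M HM] := uC _ e0.
  by exists (u M), M => // n Mn; apply: HM.
exists l => e e0; have [M _ HM] := ul _ e0.
by exists M => n Mn; rewrite distrC; apply: HM.
Qed.

Lemma rational_near (R : realType) (r eps : R) : 0 < eps ->
  exists q : rat, `|r - ratr q| < eps.
Proof.
move=> e0; have rb : ball r eps !=set0 by exists r; exact: ballxx.
by have [s [rs [q _ qs]]] := dense_rat rb (ball_open r eps); exists q; rewrite qs.
Qed.

Section ScalarTopology.
Variables (R : realType) (F : scalar_kind).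

Lemma normc_parts (z : R[i]) :
  [/\ `|complex.Re z| <= ComplexField.Normc.normc z,
      `|complex.Im z| <= ComplexField.Normc.normc z &
      ComplexField.Normc.normc z <= `|complex.Re z| + `|complex.Im z|].
Proof.
case: z => u v /=; split.
- by rewrite -sqrtr_sqr ler_wsqrtr// lerDl sqr_ge0.
- by rewrite -sqrtr_sqr ler_wsqrtr// lerDr sqr_ge0.
- rewrite -[leRHS]ger0_norm ?addr_ge0// -[leRHS]sqrtr_sqr ler_wsqrtr//.
  by rewrite sqrrD !real_normK ?num_real// addrAC lerDl mulrn_wge0// mulr_ge0.
Qed.

Lemma scalar_cauchy_converges (u : nat -> scalar_field R F) :
  (forall eps, 0 < eps -> exists M, forall m n, (M <= m)%N -> (M <= n)%N ->
     modulus (u m - u n) < eps) ->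
  exists l, forall eps, 0 < eps -> exists M, forall n, (M <= n)%N ->
     modulus (u n - l) < eps.
Proof.
case: F u => u uC; first exact: real_cauchy_converges.
have [|x ux] := @real_cauchy_converges R (fun n => complex.Re (u n)).
  move=> e e0; have [M HM] := uC _ e0; exists M => m n Mm Mn.
  apply: le_lt_trans (HM _ _ Mm Mn); case: (normc_parts (u m - u n)) => + _ _.
  by rewrite raddfB.
have [|y uy] := @real_cauchy_converges R (fun n => complex.Im (u n)).
  move=> e e0; have [M HM] := uC _ e0; exists M => m n Mm Mn.
  apply: le_lt_trans (HM _ _ Mm Mn); case: (normc_parts (u m - u n)) => _ + _.
  by rewrite raddfB.
exists (x +i* y)%C => e e0.
have [M HM] := ux _ (divr_gt0 e0 (ltr0n R 2)).
have [M' HM'] := uy _ (divr_gt0 e0 (ltr0n R 2)).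
exists (maxn M M') => n; rewrite geq_max => /andP[Mn M'n].
case: (normc_parts (u n - (x +i* y)%C)) => _ _ /le_lt_trans; apply.
by rewrite !raddfB/= (splitr e) ltrD ?HM ?HM'.
Qed.

(** Separability in the form of an enumeration indexed by a countable type:
    finite lists of indices then enumerate a dense set of finitely supported
    sequences. *)
Lemma scalar_dense_enumeration :
  exists d : rat * rat -> scalar_field R F,
    forall z eps, 0 < eps -> exists q, modulus (z - d q) < eps.
Proof.
case: F => /=.
  exists (fun q => ratr q.1) => z e /(rational_near z)[q zq].
  by exists (q, 0).
exists (fun q => (ratr q.1 +i* ratr q.2)%C) => z e e0.
have e2 := divr_gt0 e0 (ltr0n R 2).
have [q1 z1] := rational_near (complex.Re z) e2.
have [q2 z2] := rational_near (complex.Im z) e2.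
exists (q1, q2); case: (normc_parts (z - (ratr q1 +i* ratr q2)%C)) => _ _.
by move=> /le_lt_trans; apply; rewrite !raddfB/= (splitr e) ltrD.
Qed.

End ScalarTopology.

Lemma le_mul_infP (R : realType) (T : Type) (A : set T) (g : T -> R) (C v : R) :
  0 < C -> A !=set0 -> (forall t, 0 <= g t) ->
  v <= C * inf [set g t | t in A] <-> (forall t, A t -> v <= C * g t).
Proof.
move=> C0 A0 g0; split=> [vC t At|vC].
  apply: (le_trans vC); rewrite ler_pM2l//; apply: ge_inf; last by exists t.
  by exists 0 => _ [s _ <-].
rewrite -ler_pdivrMl//; apply: lb_le_inf.
  by case: A0 => t At; exists (g t); exists t.
by move=> _ [t At <-]; rewrite ler_pdivrMl//; apply: vC.
Qed.

Lemma fsum_split (V : nmodType) (A L : {fset nat}) (f : nat -> V) :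
  \sum_(n <- A) f n = \sum_(n <- (A `&` L)%fset) f n + \sum_(n <- (A `\` L)%fset) f n.
Proof.
rewrite (big_fsetID _ (mem L)) /=; congr (_ + _); apply: eq_fbigl => i.
  by rewrite !inE.
by rewrite !inE andbC.
Qed.

Lemma fset_nat_minimum (A : {fset nat}) : A != fset0 -> exists i, fset_minimum A i.
Proof.
case/fset0Pn => i iA; have ex : exists n, n \in A by exists i.
by case: (ex_minnP ex) => n nA nmin; exists n.
Qed.

Lemma fset_argmin (R : realDomainType) (A : {fset nat}) (f : nat -> R) :
  A != fset0 -> exists2 e, e \in A & forall i, i \in A -> f e <= f i.
Proof.
suff argmin (s : seq nat) : s != [::] ->
    exists2 e, e \in s & forall i, i \in s -> f e <= f i.
  case/fset0Pn => i iA; apply: argmin.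
  by have : i \in enum_fset A by []; case: (enum_fset A).
elim: s => // a [|b s] IHs _.
  by exists a => [|i]; rewrite mem_seq1// => /eqP ->.
have [e es emin] := IHs isT; have [ae|ea] := leP (f a) (f e).
  exists a => [|i]; rewrite in_cons ?eqxx// => /orP[/eqP->//|/emin].
  exact: le_trans.
exists e => [|i]; rewrite in_cons ?es ?orbT// => /orP[/eqP->|/emin//].
exact: ltW.
Qed.

Lemma fset_nat_bound (A : {fset nat}) : exists N, forall i, i \in A -> (i < N)%N.
Proof.
by exists (\max_(i <- A) i).+1 => i iA; rewrite ltnS (@leq_bigmax_seq _ (enum_fset A) xpredT id).
Qed.

Lemma fsumU (V : nmodType) (A D : {fset nat}) (f : nat -> V) :
  [disjoint A & D]%fset ->
  \sum_(n <- (A `|` D)%fset) f n = \sum_(n <- A) f n + \sum_(n <- D) f n.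
Proof.
move=> /fdisjointP AD; rewrite (fsum_split _ A).
congr (_ + _); apply: eq_fbigl => i; rewrite !inE.
  by case: (i \in A); rewrite ?andbF.
by case: (boolP (i \in A)) => //= /AD /negPf ->.
Qed.

Lemma card_fsetU_disjoint (A D : {fset nat}) :
  [disjoint A & D]%fset -> #|` (A `|` D)%fset| = (#|` A| + #|` D|)%N.
Proof. by move=> /disjoint_fsetI0 AD; rewrite cardfsU AD cardfs0 subn0. Qed.

Lemma fsum_const (V : nmodType) (A : {fset nat}) (v : V) :
  \sum_(n <- A) v = v *+ #|` A|.
Proof. by rewrite big_const_seq count_predT iter_addr addr0. Qed.

(** * Quasi-norms and coefficients *)

Section QuasiNorm.
Variables (R : realType) (F : scalar_kind) (p : R) (X : pBanach F p).
Hypothesis p_gt0 : 0 < p.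
Implicit Types x y : X.

Local Notation npow x := (qnorm x `^ p).

Lemma qnorm0 : qnorm (0 : X) = 0.
Proof. by rewrite -(scale0r (0 : X)) qnorm_homogeneous modulus0 mul0r. Qed.

Lemma qnormN x : qnorm (- x) = qnorm x.
Proof. by rewrite -scaleN1r qnorm_homogeneous modulusN modulus1 mul1r. Qed.

Lemma npow0 : npow (0 : X) = 0.
Proof. by rewrite qnorm0 powR0// gt_eqF. Qed.

Lemma npow_sub x y : npow (x - y) <= npow x + npow y.
Proof. by rewrite -(qnormN y) qnorm_ptriangle. Qed.

Lemma npow_sum (I : Type) (s : seq I) (P : pred I) (f : I -> X) :
  npow (\sum_(i <- s | P i) f i) <= \sum_(i <- s | P i) npow (f i).
Proof.
elim: s => [|i s IHs]; first by rewrite !big_nil npow0.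
rewrite !big_cons; case: (P i) => //.
by rewrite (le_trans (qnorm_ptriangle _ _))// lerD2l.
Qed.

Lemma npow_le_of_qnorm (C : R) x y : 0 <= C ->
  qnorm x <= C * qnorm y -> npow x <= C `^ p * npow y.
Proof.
move=> C0 xy; rewrite -powRM ?qnorm_ge0//.
by rewrite ge0_ler_powR ?nnegrE ?mulr_ge0 ?qnorm_ge0// ltW.
Qed.

Lemma qnorm_le_of_npow (c : R) x y : 0 <= c ->
  npow x <= c * npow y -> qnorm x <= c `^ p^-1 * qnorm y.
Proof.
move=> c0 xy; have r (z : X) : (npow z) `^ p^-1 = qnorm z.
  by rewrite -powRrM divff ?gt_eqF// powRr1// qnorm_ge0.
rewrite -(r x) -(r y) -powRM ?powR_ge0//.
by rewrite ge0_ler_powR ?nnegrE ?mulr_ge0 ?powR_ge0// invr_ge0 ltW.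
Qed.

(** Homogeneity reduces to the unit ball; the normalizing scalar only needs the
    right modulus. *)
Lemma dual_norm_bound (f : {scalar X}) (K : R) x :
  (dual_norm f <= K%:E)%E -> modulus (f x) <= K * qnorm x.
Proof.
move=> fK; have [x0|x0] := eqVneq (qnorm x) 0.
  by rewrite x0 mulr0 (qnorm_definite x0) linear0 modulus0.
have xgt0 : 0 < qnorm x by rewrite lt_neqAle eq_sym x0 qnorm_ge0.
have [c cE] : exists c : scalar_field R F, modulus c = (qnorm x)^-1.
  by apply: exists_scalar_of_modulus; rewrite invr_ge0 qnorm_ge0.
have : ((modulus (f (c *: x)))%:E <= dual_norm f)%E.
  apply: ereal_sup_ubound; exists (c *: x) => //=.
  by rewrite qnorm_homogeneous cE mulVf.
move=> /le_trans/(_ fK); rewrite linearZ/= modulusM cE lee_fin.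
by rewrite ler_pdivrMl// mulrC.
Qed.

Section Coefficients.
Variable B : pbasis X.

Lemma bounded_basis : exists K : R,
  [/\ 0 < K, forall n, qnorm (B n) <= K &
      forall n x, modulus (coef B n x) <= K * qnorm x].
Proof.
have := bvec_coef_bounded B; set s := ereal_sup _ => sfin.
have ub t : norm_values B (coef B) t -> (t <= (Num.max 1 (fine s))%:E)%E.
  move=> vt; apply: (@le_trans _ _ s); first exact: ereal_sup_ubound.
  by case: s sfin => //= [r _|_]; rewrite ?leNye// lee_fin le_max lexx orbT.
exists (Num.max 1 (fine s)); split; first by rewrite lt_max ltr01.
  by move=> n; rewrite -lee_fin; apply: ub; left; exists n.
by move=> n x; apply: dual_norm_bound; apply: ub; right; exists n.
Qed.

Lemma coef_fsum (S : {fset nat}) (c : nat -> scalar_field R F) i :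
  coef B i (\sum_(n <- S) c n *: B n) = if i \in S then c i else 0.
Proof.
rewrite linear_sum/=.
under eq_bigr do rewrite linearZ/= (coef_biorthogonal B).
case: ifPn => iS.
  rewrite (big_fsetD1 i)//= eqxx mulr1 big_seq big1 ?addr0// => n.
  by rewrite !inE eq_sym => /andP[/negPf-> _]; rewrite mulr0.
rewrite big_seq big1// => n nS; case: eqP => [E|]; last by rewrite mulr0.
by rewrite E nS in iS.
Qed.

Lemma coef_coord_proj (S : {fset nat}) x i :
  coef B i (coord_proj B S x) = if i \in S then coef B i x else 0.
Proof. exact: coef_fsum. Qed.

Lemma partial_sumE k x :
  partial_sum B k x = coord_proj B [fset n in iota 0 k]%fset x.
Proof.
rewrite /partial_sum /coord_proj big_imfset//= undup_id ?iota_uniq//.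
by rewrite -(big_mkord xpredT (fun n => coef B n x *: B n)) /index_iota subn0.
Qed.

(** Finite combinations of the basis vectors are dense and have coefficients
    that vanish eventually, while the functionals are uniformly bounded. *)
Lemma coef_tends_to_0 x (eps : R) : 0 < eps ->
  exists N, forall n, (N <= n)%N -> modulus (coef B n x) < eps.
Proof.
move=> e0; have [K [K0 _ coefK]] := bounded_basis.
have [_ [N [c ->]] xy] := bvec_span_dense B x (divr_gt0 e0 K0).
exists N => n Nn; set y := \sum_(i < N) _ in xy.
have -> : coef B n x = coef B n (x - y).
  rewrite linearB/= linear_sum big1 ?subr0//= => i _.
  rewrite linearZ/= (coef_biorthogonal B) gtn_eqF ?mulr0//.
  exact: leq_trans (ltn_ord i) Nn.
by apply: le_lt_trans (coefK _ _) _; rewrite mulrC -ltr_pdivlMr.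
Qed.

End Coefficients.
End QuasiNorm.

(** * Almost greedy bases are minimum partially greedy *)

Section Implications.
Variables (R : realType) (F : scalar_kind) (p : R) (X : pBanach F p).
Hypothesis p_gt0 : 0 < p.
Variable B : pbasis X.
Implicit Types (x : X) (FF : set {fset nat}).

Local Notation npow x := (qnorm x `^ p).

Lemma admissible_competitors0 FF (L : {fset nat}) m : FF fset0 ->
  [set A | [/\ FF A, (#|` A| <= m)%N & min_before A L]] !=set0.
Proof. by move=> FF0; exists fset0; split; rewrite ?cardfs0//; left. Qed.

(** A competitor [A] of size less than [m] is enlarged to size [m] by positions
    so far away that the coefficients of [x] there are negligible. *)
Lemma almost_greedy_minimum_partially_greedy FF : FF fset0 ->
  almost_greedy B -> minimum_partially_greedy B FF.
Proof.
move=> FF0 [C C0 AG]; have [K [K0 basisK _]] := bounded_basis B.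
exists (Num.max 1 C); first by rewrite le_max lexx.
move=> x m L m0 Lx.
apply/le_mul_infP; first by rewrite lt_max ltr01.
- exact: admissible_competitors0.
- by move=> A; exact: qnorm_ge0.
move=> A [_ Am _].
suff : qnorm (x - coord_proj B L x) <= C * qnorm (x - coord_proj B A x).
  move=> /le_trans; apply; rewrite ler_wpM2r ?qnorm_ge0//.
  by rewrite le_max lexx orbT.
have -> : C = (C `^ p) `^ p^-1.
  by rewrite -powRrM divff ?gt_eqF// powRr1// ltW.
apply: qnorm_le_of_npow => //; first exact: powR_ge0.
apply/ler_addgt0Pr => e e0.
(* [m] discarded terms, each of size at most [K * eta], cost at most [e]. *)
pose d := e / (C `^ p * m%:R); pose eta := d `^ p^-1 / K.
have Cp0 : 0 < C `^ p by exact: powR_gt0.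
have d0 : 0 < d by rewrite divr_gt0// mulr_gt0// ltr0n.
have eta0 : 0 < eta by rewrite divr_gt0// powR_gt0.
have etaK : (eta * K) `^ p = d.
  rewrite /eta divfK ?gt_eqF// -powRrM mulVf ?gt_eqF// powRr1//.
  exact: ltW.
have [N xN] := coef_tends_to_0 B x eta0.
have [N' AN'] := fset_nat_bound A.
pose D := [fset n in iota (maxn N N') (m - #|` A|)]%fset.
have DN n : n \in D -> (N <= n)%N && (N' <= n)%N.
  by rewrite !inE/= mem_iota geq_max => /andP[].
have AD : [disjoint A & D]%fset.
  apply/fdisjointP => n nA; apply/negP => /DN /andP[_].
  by rewrite leqNgt AN'.
have cD : #|` D| = (m - #|` A|)%N.
  by rewrite card_fseq undup_id ?iota_uniq// size_iota.
have cAD : #|` (A `|` D)%fset| = m by rewrite card_fsetU_disjoint// cD subnKC.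
have := AG x m L m0 Lx.
move/le_mul_infP => /(_ C0 (ex_intro _ _ cAD) (fun=> qnorm_ge0 _) _ cAD).
move=> /(npow_le_of_qnorm p_gt0 (ltW C0)) /le_trans; apply.
have -> : x - coord_proj B (A `|` D)%fset x = (x - coord_proj B A x) - coord_proj B D x.
  by rewrite /coord_proj fsumU// opprD addrA.
have De : npow (coord_proj B D x) <= d * m%:R.
  apply: le_trans (npow_sum _ _ _ _) _ => //.
  apply: (@le_trans _ _ (\sum_(n <- D) d)).
    rewrite big_seq [leRHS]big_seq; apply: ler_sum => n /DN /andP[Nn _].
    rewrite -etaK ge0_ler_powR ?nnegrE ?qnorm_ge0 ?mulr_ge0
      ?(ltW p_gt0) ?powR_ge0 ?invr_ge0 ?(ltW K0)//.
    rewrite qnorm_homogeneous ler_pM ?modulus_ge0 ?qnorm_ge0//.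
    exact/ltW/xN.
  by rewrite fsum_const cD -[leLHS]mulr_natr ler_wpM2l ?ler_nat ?leq_subr// ltW.
have -> : e = C `^ p * (d * m%:R).
  by rewrite /d invfM; field; rewrite ?gt_eqF ?ltr0n.
rewrite -mulrDr ler_wpM2l ?powR_ge0//.
by apply: le_trans (npow_sub _ _) _; rewrite lerD2l.
Qed.

End Implications.

(** * Minimum partially greedy bases are strong partially greedy *)

Section Covering.
Variables (R : realType) (F : scalar_kind) (p : R) (X : pBanach F p).
Hypothesis p_gt0 : 0 < p.
Variable B : pbasis X.
Variable FF : set {fset nat}.

Local Notation npow x := (qnorm x `^ p).

Section Replacement.
Variables (Delta : R) (x : X) (m k : nat) (L : {fset nat}).
Hypothesis Delta_ge1 : 1 <= Delta.
Hypothesis FF_greedy : forall (y : X) (m' : nat) (L' A : {fset nat}), (0 < m')%N ->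
  greedy_set B y m' L' -> FF A -> (#|` A| <= m')%N -> min_before A L' ->
  qnorm (y - coord_proj B L' y) <= Delta * qnorm (y - coord_proj B A y).
Hypothesis FF0 : FF fset0.
Hypothesis Lx : greedy_set B x m L.
Hypothesis km : (k <= m)%N.

Let K := [fset n in iota 0 k]%fset.
Let D := (K `\` L)%fset.
Let E := (L `\` K)%fset.
Let y0 := x - coord_proj B K x.
Let r := y0 - coord_proj B E x.

Let inK n : (n \in K) = (n < k)%N.
Proof. by rewrite !inE/= mem_iota. Qed.

(** The error splits into the error of a greedy step on the tail [y0] and the
    head coefficients that [L] misses; only the latter need nonempty competitors. *)
Lemma greedy_residual_split : x - coord_proj B L x = r + coord_proj B D x.
Proof.
rewrite /r /y0 /coord_proj (fsum_split L K) (fsum_split K L).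
by rewrite (fsetIC L K) !opprD !addrA [RHS]addrAC subrK.
Qed.

(** This is where [k <= m] enters. *)
Lemma card_head_le_tail : (#|` D| <= #|` E|)%N.
Proof.
have [cL _] := Lx; have := cardfsID K L; have := cardfsID L K.
have -> : #|` K| = k by rewrite card_fseq undup_id ?iota_uniq// size_iota.
rewrite cL (fsetIC K) -/D -/E => cK cL'.
by move: km; rewrite -cK -cL' leq_add2l.
Qed.

Lemma coef_tail n : coef B n y0 = if (n < k)%N then 0 else coef B n x.
Proof.
rewrite linearB/= coef_coord_proj inK; case: ifP; rewrite ?subrr ?subr0//.
Qed.

Lemma tail_coord_proj : coord_proj B E y0 = coord_proj B E x.
Proof.
rewrite /coord_proj big_seq [RHS]big_seq; apply: eq_bigr => n.
by rewrite in_fsetD inK coef_tail => /andP[/negPf ->].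
Qed.

(** [E] is a greedy set of [y0], and the empty competitor belongs to [FF]. *)
Lemma tail_residual_bound : qnorm r <= Delta * qnorm y0.
Proof.
have [E0|E0] := posnP #|` E|.
  rewrite /r (cardfs0_eq E0) /coord_proj big_seq_fset0 subr0.
  by rewrite ler_peMl ?qnorm_ge0.
have := @FF_greedy y0 #|` E| E fset0 E0.
rewrite tail_coord_proj /coord_proj big_seq_fset0 subr0; apply=> //.
- split=> // i j; rewrite !coef_tail in_fsetD inK => /andP[/negPf-> iL].
  rewrite in_fsetD inK negb_and negbK.
  case: ifPn => [_ _|_ /= jL]; first by rewrite modulus0 modulus_ge0.
  by case: Lx => _; apply.
- by left.
Qed.

(** The discarded head coefficients lying in a set [A] of the family are
    recovered from the tail: in [y0 + sum of c n * e_n over A], where [c] copies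
    [x] on [D'] and equals the least tail coefficient elsewhere on [A], the
    competitor [A] leaves [y0], whereas the greedy choice that passes over [D'] leaves
    [r + coord_proj D' x]. *)
Lemma head_piece_bound (A D' : {fset nat}) :
  FF A -> (forall n, n \in A -> (n < k)%N) ->
  (D' `<=` A)%fset -> (D' `<=` D)%fset ->
  npow (coord_proj B D' x) <= 2 * Delta `^ p * npow y0.
Proof.
move=> FA Ak D'A D'D; have Delta0 : 0 <= Delta := le_trans ler01 Delta_ge1.
have [->|D'0] := eqVneq D' fset0.
  rewrite /coord_proj big_seq_fset0 (npow0 _ p_gt0).
  by rewrite !mulr_ge0 ?powR_ge0.
have E0 : E != fset0.
  rewrite -cardfs_gt0 (leq_trans _ card_head_le_tail)// cardfs_gt0.
  by apply: contraNneq D'0 => D0; rewrite -fsubset0 -D0.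
have [t [tE tD]] : exists t : scalar_field R F,
    (forall i, i \in E -> modulus t <= modulus (coef B i x))
    /\ (forall j, j \notin L -> modulus (coef B j x) <= modulus t).
  have [e eE emin] := fset_argmin (fun i => modulus (coef B i x)) E0.
  exists (coef B e x); split=> // j jL.
  by case: Lx => _; apply=> //; move: eE; rewrite in_fsetD => /andP[].
pose c n := if n \in D' then coef B n x else t.
pose y := y0 + \sum_(n <- A) c n *: B n.
pose L' := (E `|` (A `\` D'))%fset.
have coefy n : coef B n y = if n \in A then c n else coef B n y0.
  rewrite linearD/= coef_fsum; case: ifPn => [/Ak nk|]; rewrite ?addr0//.
  by rewrite coef_tail nk add0r.
have EA n : n \in E -> n \notin A.
  by rewrite in_fsetD inK => /andP[nk _]; apply: contra nk => /Ak.
have EAD : [disjoint E & A `\` D']%fset.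
  by apply/fdisjointP => n /EA nA; rewrite in_fsetD (negPf nA) andbF.
have cL' : #|` L'| = (#|` E| + (#|` A| - #|` D'|))%N.
  by rewrite card_fsetU_disjoint// cardfsDS.
have D'le : (#|` D'| <= #|` E|)%N.
  exact: leq_trans (fsubset_leq_card D'D) card_head_le_tail.
have AL' : (#|` A| <= #|` L'|)%N by rewrite cL'; lia.
have yA : y - coord_proj B A y = y0.
  rewrite /coord_proj {1}/y; apply/eqP; rewrite subr_eq; apply/eqP; congr (_ + _).
  by rewrite big_seq [RHS]big_seq; apply: eq_bigr => n nA; rewrite coefy nA.
have yL' : y - coord_proj B L' y = r + coord_proj B D' x.
  rewrite {1}/y (fsum_split A D') (fsetIidPr D'A) {1}/coord_proj fsumU//.
  have -> : \sum_(n <- E) coef B n y *: B n = coord_proj B E x.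
    rewrite -tail_coord_proj /coord_proj big_seq [RHS]big_seq.
    by apply: eq_bigr => n /EA /negPf nA; rewrite coefy nA.
  have -> : \sum_(n <- (A `\` D')%fset) coef B n y *: B n =
            \sum_(n <- (A `\` D')%fset) c n *: B n.
    rewrite big_seq [RHS]big_seq; apply: eq_bigr => n.
    by rewrite in_fsetD coefy => /andP[_ ->].
  have -> : \sum_(n <- D') c n *: B n = coord_proj B D' x.
    rewrite /coord_proj big_seq [RHS]big_seq; apply: eq_bigr => n nD'.
    by rewrite /c nD'.
  by rewrite /r opprD !addrA [LHS]addrAC addrK addrAC.
have L'y : greedy_set B y #|` L'| L'.
  split=> // i j; rewrite !in_fsetU !in_fsetD => iL' jL'.
  apply: (@le_trans _ _ (modulus t)).
    rewrite coefy; case: ifPn => [jA|jA].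
      rewrite /c; case: ifPn => // /(fsubsetP D'D).
      by rewrite in_fsetD => /andP[jL _]; apply: tD.
    rewrite coef_tail; case: ifPn => jk; first by rewrite modulus0 modulus_ge0.
    by apply: tD; move: jL'; rewrite inK jk/= negb_or => /andP[].
  case/orP: iL' => [iE|/andP[iD' iA]].
    have iEE : i \in E by rewrite in_fsetD.
    rewrite coefy (negPf (EA _ iEE)) coef_tail ifN; last by rewrite -inK; case/andP: iE.
    exact: tE.
  by rewrite coefy iA /c (negPf iD').
have L'0 : (0 < #|` L'|)%N by rewrite cL' addn_gt0 cardfs_gt0 E0.
have AL : min_before A L'.
  right; have [i [iA imin]] : exists i, fset_minimum A i.
    apply: fset_nat_minimum; apply: contraNneq D'0 => A0.
    by rewrite -fsubset0 -A0.
  exists i => // n; rewrite in_fsetU => /orP[|].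
    rewrite in_fsetD inK -leqNgt => /andP[kn _].
    exact: leq_trans (ltnW (Ak _ iA)) kn.
  by rewrite in_fsetD => /andP[_ /imin].
have := FF_greedy L'0 L'y FA AL' AL; rewrite yL' yA.
move=> /(npow_le_of_qnorm p_gt0 Delta0) H.
have -> : coord_proj B D' x = (r + coord_proj B D' x) - r by rewrite addrC addKr.
apply: le_trans (npow_sub _ _) _.
rewrite -mulrA mulr_natl mulr2n lerD//.
exact: (npow_le_of_qnorm p_gt0 Delta0 tail_residual_bound).
Qed.

(** A single missed head coefficient is smaller than some tail coefficient, which
    the functionals read off from [y0]. *)
Lemma head_coef_bound (C : R) : 0 < C -> (forall n, qnorm (B n) <= C) ->
  (forall n z, modulus (coef B n z) <= C * qnorm z) ->
  forall n, n \in D -> npow (coef B n x *: B n) <= (C * C) `^ p * npow y0.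
Proof.
move=> C0 normC coefC n nD.
have [e eE] : exists e, e \in E.
  apply/fset0Pn; rewrite -cardfs_gt0 (leq_trans _ card_head_le_tail)//.
  by rewrite cardfs_gt0; apply/fset0Pn; exists n.
have ne : modulus (coef B n x) <= modulus (coef B e x).
  case: Lx => _; apply; first by move: eE; rewrite in_fsetD => /andP[].
  by move: nD; rewrite in_fsetD => /andP[].
apply: (npow_le_of_qnorm p_gt0); first by rewrite mulr_ge0// ltW.
rewrite qnorm_homogeneous mulrAC ler_pM ?modulus_ge0 ?qnorm_ge0//.
apply: (le_trans ne).
have -> : coef B e x = coef B e y0.
  by rewrite coef_tail ifN// -inK; move: eE; rewrite in_fsetD => /andP[].
exact: coefC.
Qed.

End Replacement.

(** If, apart from the first [N0] positions, every initial segment is covered by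
    boundedly many members of [FF] that it contains, then the head of [x] is
    controlled piece by piece and the greedy residual by the tail of [x]. *)
Lemma minimum_partially_greedy_of_cover (M N0 : nat) : FF fset0 ->
  (forall k, exists A : nat -> {fset nat},
     (forall j, (j < M)%N -> FF (A j) /\ forall n, n \in A j -> (n < k)%N) /\
     (forall n, (N0 <= n)%N -> (n < k)%N -> exists2 j, (j < M)%N & n \in A j)) ->
  minimum_partially_greedy B FF -> strong_partially_greedy B.
Proof.
move=> FF0 cover [Delta Delta1 mpg].
have Delta0 : 0 < Delta := lt_le_trans ltr01 Delta1.
have FF_greedy (y : X) (m' : nat) (L' A : {fset nat}) : (0 < m')%N ->
  greedy_set B y m' L' -> FF A -> (#|` A| <= m')%N -> min_before A L' ->
  qnorm (y - coord_proj B L' y) <= Delta * qnorm (y - coord_proj B A y).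
  move=> m'0 L'y FA Am AL'; have := mpg y m' L' m'0 L'y.
  move/le_mul_infP; apply=> //; first exact: admissible_competitors0.
  by move=> ?; apply: qnorm_ge0.
have [C [C0 normC coefC]] := bounded_basis B.
(* One term for the tail, one for each of the [M] pieces of the head, and one for
   each of the [N0] positions that the pieces may miss. *)
pose c := Delta `^ p + (2 * Delta `^ p) *+ M + ((C * C) `^ p) *+ N0.
have c0 : 0 < c.
  rewrite ltr_wpDr// ?mulrn_wge0 ?powR_ge0//.
  by rewrite ltr_wpDr ?powR_gt0// mulrn_wge0// mulr_ge0// powR_ge0.
exists (c `^ p^-1); first exact: powR_gt0.
move=> x m L m0 Lx; apply/le_mul_infP; first exact: powR_gt0.
- by exists 0%N.
- by move=> A; exact: qnorm_ge0.
move=> k km; apply: qnorm_le_of_npow => //; first exact: ltW.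
rewrite partial_sumE (greedy_residual_split x k L).
set K := [fset n in iota 0 k]%fset; set y0 := x - coord_proj B K x.
apply: le_trans (qnorm_ptriangle _ _) _.
have [A [FA Acover]] := cover k.
set D := (K `\` L)%fset.
have DK n : n \in D -> (n < k)%N.
  by rewrite in_fsetD !inE/= mem_iota => /and3P[].
(* The pieces may overlap, so each position is assigned to the first one that
   contains it; the value [M] marks the positions that are in none. *)
pose piece n := find (fun j => n \in A j) (iota 0 M).
have pieceM n : (piece n < M.+1)%N.
  by rewrite ltnS -[leqRHS](size_iota 0) find_size.
have pieceA n : (piece n < M)%N -> n \in A (piece n).
  move=> nM; have : has (fun j => n \in A j) (iota 0 M) by rewrite has_find size_iota.
  by move=> /(nth_find 0%N); rewrite nth_iota.
have piece_small n : n \in D -> piece n = M -> (n < N0)%N.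
  move=> nD nM; rewrite ltnNge; apply/negP => N0n.
  have [j jM nAj] := Acover n N0n (DK _ nD).
  suff : has (fun j => n \in A j) (iota 0 M).
    by rewrite has_find -/(piece n) nM size_iota ltnn.
  by apply/hasP; exists j => //; rewrite mem_iota.
rewrite /c -[in leRHS]addrA mulrDl lerD//.
  apply: (npow_le_of_qnorm p_gt0 (ltW Delta0)).
  exact: (tail_residual_bound k Delta1 FF_greedy FF0 Lx).
rewrite {1}/coord_proj (partition_big (fun n => Ordinal (pieceM n)) predT)//=.
rewrite big_ord_recr/=; apply: le_trans (qnorm_ptriangle _ _) _.
rewrite mulrDl lerD//.
  apply: le_trans (npow_sum p_gt0 _ _ _) _.
  apply: (@le_trans _ _ (\sum_(j < M) 2 * Delta `^ p * npow y0)); last first.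
    by rewrite sumr_const card_ord; rewrite -[leLHS]mulrnAl lexx.
  apply: ler_sum => j _; rewrite big_fset_condE.
  have [FAj Ajk] := FA j (ltn_ord j).
  apply: (head_piece_bound Delta1 FF_greedy FF0 Lx km FAj) => //.
    apply/fsubsetP => n; rewrite !inE/= => /andP[_ /eqP/(congr1 val)/= E].
    by rewrite -E pieceA// E.
  by apply/fsubsetP => n; rewrite !inE/= => /andP[].
apply: le_trans (npow_sum p_gt0 _ _ _) _.
set S := [seq n <- D | (n < N0)%N].
apply: (@le_trans _ _ (\sum_(n <- S) (C * C) `^ p * npow y0)).
  rewrite big_filter big_seq_cond [leRHS]big_seq_cond.
  rewrite big_mkcond [leRHS]big_mkcond; apply: ler_sum => n _.
  case: (boolP (n \in D)) => nD /=; last by [].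
  case: eqP => [/(congr1 val)/= E|_].
    by rewrite piece_small// (head_coef_bound Lx km).
  by case: ifP => //; rewrite mulr_ge0// powR_ge0.
rewrite big_const_seq count_predT iter_addr addr0 -mulrnAl ler_wpM2r ?powR_ge0//.
rewrite ler_wpMn2l ?powR_ge0// -(size_iota 0 N0); apply: uniq_leq_size.
  exact/filter_uniq/fset_uniq.
by move=> n; rewrite mem_filter mem_iota => /andP[].
Qed.

End Covering.

(** * Partial sums and their gaps *)

Section PartialSums.
Variable a : nat -> nat.
Hypothesis a_gt0 : forall n, (0 < a n)%N.
Local Open Scope nat_scope.

(** Positions are counted from 0, hence the predecessor; [shifted_sums a k l]
    consists of [k + psum 0], and so on up to [k + psum l.-1]. *)
Definition psum j := (\sum_(i < j.+1) a i).-1.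

Lemma psumS j : psum j.+1 = psum j + a j.+1.
Proof.
rewrite /psum big_ord_recr/= -[X in (X + _).-1]prednK.
  by rewrite addSn.
by rewrite big_ord_recl/= addn_gt0 a_gt0.
Qed.

Lemma psum_le i j : (psum i <= psum j) = (i <= j).
Proof.
apply: (leq_mono (f := psum)); apply: homo_ltn => [? ? ?|n]; first exact: ltn_trans.
by rewrite psumS -[ltnLHS]addn0 ltn_add2l.
Qed.

Lemma psum_lt i j : (psum i < psum j) = (i < j).
Proof. by rewrite !ltnNge psum_le. Qed.

Lemma psum_ge j : j <= psum j.
Proof.
elim: j => // j IHj; rewrite psumS -addn1.
exact: leq_add IHj (a_gt0 _).
Qed.

Lemma shifted_sum_psum k j : (k + \sum_(i < j.+1) a i).-1 = k + psum j.
Proof.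
rewrite /psum; have : 0 < \sum_(i < j.+1) a i.
  by rewrite big_ord_recl addn_gt0 a_gt0.
by case: (\sum_(i < j.+1) a i) => // s _; rewrite addnS.
Qed.

Lemma mem_shifted_sums k l n :
  reflect (exists2 j, j < l & n = k + psum j) (n \in shifted_sums a k l).
Proof.
apply: (iffP (imfsetP _ _ _ _)) => [[j]|[j jl ->]].
  by rewrite /= mem_iota => /andP[_ jl] ->; exists j; rewrite ?shifted_sum_psum.
by exists j; rewrite /= ?mem_iota// shifted_sum_psum.
Qed.

Lemma psum_inj : injective psum.
Proof. by move=> i j E; apply/eqP; rewrite eqn_leq -(psum_le i) -(psum_le j) E leqnn. Qed.

Lemma card_shifted_sums k l : #|` shifted_sums a k l| = l.
Proof.
rewrite card_imfset/= ?undup_id ?iota_uniq ?size_iota// => i j /=.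
by rewrite !shifted_sum_psum => /addnI/psum_inj.
Qed.

Lemma psum_bracket n : psum 0 <= n -> exists2 i, psum i <= n & n < psum i.+1.
Proof.
move=> n0; have ex : exists i, n < psum i by exists n.+1; exact: psum_ge.
case: (ex_minnP ex) => -[|i] ni imin; first by rewrite ltnNge n0 in ni.
by exists i => //; rewrite leqNgt; apply/negP => /imin; rewrite ltnn.
Qed.

Lemma shift_cutoff k j : exists l, forall i, (i < l) = (j + psum i < k).
Proof.
have ex : exists i, k <= j + psum i.
  by exists k; rewrite (leq_trans (psum_ge k))// leq_addl.
case: (ex_minnP ex) => l kl lmin; exists l => i.
apply/idP/idP => [il|].
  by rewrite ltnNge; apply/negP => /lmin; rewrite leqNgt il.
rewrite ltnNge [in X in _ -> X]ltnNge; apply: contra => li.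
by rewrite (leq_trans kl)// leq_add2l psum_le.
Qed.

Lemma fset0_in_seq_family : seq_family a fset0.
Proof. by left. Qed.

(** Consecutive partial sums differ by at most [M], so the first [M] shifts of
    the sequence of partial sums exhaust all positions from the first one on. *)
Lemma seq_family_cover M : (forall n, a n <= M) ->
  forall k, exists A : nat -> {fset nat},
    (forall j, j < M -> seq_family a (A j) /\ forall n, n \in A j -> n < k) /\
    (forall n, psum 0 <= n -> n < k -> exists2 j, j < M & n \in A j).
Proof.
move=> aM k; have [l lP] := choice (shift_cutoff k).
exists (fun j => shifted_sums a j (l j)); split=> [j _|n n0 nk].
  split; last by move=> n /mem_shifted_sums [i il ->]; rewrite -lP.
  case: (posnP (l j)) => [l0|l0]; last by right; exists j, (l j).
  by left; apply/cardfs0_eq; rewrite card_shifted_sums.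
have [i i1 i2] := psum_bracket n0.
exists (n - psum i).
  by rewrite ltn_subLR// (leq_trans i2)// psumS leq_add2l.
by apply/mem_shifted_sums; exists i; rewrite ?lP subnK.
Qed.

(** Positions before the first partial sum are left out: a competitor must start
    no later than the greedy set, so greedy positions are compared with a shift
    of the partial sums only beyond its first element. *)
Definition gap i := `[< psum 0 < i /\ forall j, psum j <> i >].

Definition gap_count n := count gap (iota 0 n.+1).

Lemma gap_count_mono m n : m <= n -> gap_count m <= gap_count n.
Proof.
move=> mn; rewrite /gap_count -(subnK mn) addnC -addSn iotaD count_cat.
exact: leq_addr.
Qed.

Lemma gap_between i n : psum i < n -> n < psum i.+1 -> gap n.
Proof.
move=> i1 i2; apply/asboolP; split.
  by rewrite (leq_ltn_trans _ i1)// psum_le.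
by move=> j E; move: i1 i2; rewrite -E !psum_lt ltnS => ij; rewrite leqNgt ij.
Qed.

(** Between two consecutive partial sums everything but the endpoint is a gap, so
    the gaps are counted by the excesses of the terms over 1. *)
Lemma gap_count_psum n : gap_count (psum n) = \sum_(i < n) (a i.+1).-1.
Proof.
elim: n => [|n IHn].
  rewrite big_ord0; apply/eqP; rewrite -leqn0 leqNgt -has_count.
  apply/hasPn => i; rewrite mem_iota ltnS/= => i0.
  by apply/negP => /asboolP[]; rewrite ltnNge i0.
have := psumS n; rewrite big_ord_recr/= -IHn.
case: (a n.+1) (a_gt0 n.+1) => // d _ /= dE.
have psum1 : (psum n.+1).+1 = (psum n).+1 + (d + 1) by rewrite dE; lia.
rewrite /gap_count psum1 !iotaD !count_cat add0n; congr (_ + _).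
have -> : count gap (iota (psum n).+1 d) = d.
  rewrite -[RHS](size_iota (psum n).+1); apply/eqP; rewrite -all_count.
  apply/allP => i; rewrite mem_iota => /andP[i1 i2].
  by apply: (gap_between i1); rewrite dE; lia.
rewrite /= addn0 [X in _ + X](_ : _ = 0) ?addn0//; apply/eqP; rewrite eqb0.
by apply/negP => /asboolP[_ /(_ n.+1)]; apply; rewrite dE; lia.
Qed.

Lemma gap_count_unbounded :
  (forall N, exists2 n, N <= n & 2 <= a n) -> forall h, exists n, h <= gap_count n.
Proof.
move=> ainf; elim=> [|h [n hn]]; first by exists 0.
have [[//|m] nm am] := ainf n.+1; exists (psum m.+1).
have nm' : n <= psum m by rewrite (leq_trans _ (psum_ge m)).
rewrite gap_count_psum big_ord_recr/= -gap_count_psum -addn1 leq_add//.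
  exact: leq_trans hn (gap_count_mono nm').
by case: (a m.+1) am.
Qed.

Lemma gap_count_le_jumps M n : (forall n, a n <= M) ->
  gap_count n <= M * #|[pred i : 'I_n.+1 | 2 <= a i]|.
Proof.
move=> aM; apply: leq_trans (gap_count_mono (psum_ge n)) _.
rewrite gap_count_psum -sum1_card big_distrr/=.
rewrite [leqRHS]big_mkcond/= big_ord_recl/=.
apply: leq_trans (leq_addl _ _); apply: leq_sum => i _.
rewrite inE lift0; case: ifPn => [_|].
  by rewrite muln1 (leq_trans (leq_pred _)).
by rewrite -ltnNge ltnS; have := a_gt0 i.+1; case: (a i.+1) => [|[|]].
Qed.

End PartialSums.

(** The number of gaps up to [n] is at most [M] times the number of terms
    exceeding 1, which grows at most like the fourth root of [n]. *)
Lemma gap_count_sublinear (R : realType) (a : nat -> nat) (M : nat) (alpha : R) :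
  (forall n, (0 < a n)%N) -> (forall n, (a n <= M)%N) ->
  (forall m : nat, (0 < m)%N ->
     #|[pred n : 'I_m | (2 <= a n)%N]|%:R <= alpha * m%:R `^ (4%:R^-1)) ->
  forall C, exists n, (C * (gap_count a n).+1 < n)%N.
Proof.
move=> a0 aM asp C.
have [A alphaA] : exists A : nat, alpha <= A%:R.
  by exists (Num.truncn alpha).+1; apply/ltW/truncnS_gt.
(* At the fourth power of [t] the hypothesis bounds the gaps linearly in [t]; any
   [t] above the slope [be] of that bound will do. *)
pose be := (C * (M * A).+1)%N; pose t := be.+2.
have t4 : ((t ^ 4).-1.+1 = t ^ 4)%N by rewrite prednK// expn_gt0.
exists (t ^ 4).-1.
have cardt : (#|[pred n : 'I_(t ^ 4).-1.+1 | (2 <= a n)%N]| <= A * t)%N.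
  rewrite -(ler_nat R) natrM; apply: le_trans (asp _ _) _ => //.
  rewrite t4 natrX -powR_mulrn// -powRrM mulfV ?pnatr_eq0// powRr1//.
  by rewrite ler_wpM2r.
have Ht : (gap_count a (t ^ 4).-1 <= M * (A * t))%N.
  exact: leq_trans (gap_count_le_jumps a0 _ aM) (leq_mul _ _).
have step : (C * (gap_count a (t ^ 4).-1).+1 <= be * t)%N.
  rewrite /be -mulnA leq_mul2l; apply/orP; right.
  by rewrite mulSn mulnA in Ht *; lia.
apply: leq_ltn_trans step _.
have : (t ^ 2 <= t ^ 4)%N by rewrite leq_pexp2l.
by rewrite -t4 !expnS expn0 /t; nia.
Qed.

(** * Schreier-type sequence spaces *)

(** For a nondecreasing gauge [phi] this is the Schreier condition that the size
    of [A] be at most [phi (min A)]; asking it of all elements makes it inherited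
    by subsets for every [phi]. *)
Definition admissible (phi : nat -> nat) (A : {fset nat}) : Prop :=
  forall i, i \in A -> (#|` A| <= phi i)%N.

Lemma admissible_sub phi (A D : {fset nat}) :
  (D `<=` A)%fset -> admissible phi A -> admissible phi D.
Proof.
move=> DA adA i iD; apply: leq_trans (fsubset_leq_card DA) (adA i _).
exact: (fsubsetP DA).
Qed.

Lemma admissible0 phi : admissible phi fset0.
Proof. by move=> i; rewrite inE. Qed.

Lemma admissible1 phi i : (0 < phi i)%N -> admissible phi [fset i]%fset.
Proof. by move=> phi_i j; rewrite inE cardfs1 => /eqP ->. Qed.

Section SchreierSpace.
Variables (R : realType) (F : scalar_kind) (phi : nat -> nat).
Local Notation K := (scalar_field R F).

Definition modulus_sum (x : nat -> K) (A : {fset nat}) : R :=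
  \sum_(i <- A) modulus (x i).

Lemma modulus_sum_ge0 x A : 0 <= modulus_sum x A.
Proof. by apply: sumr_ge0 => i _; exact: modulus_ge0. Qed.

Lemma modulus_sum_sub x (A D : {fset nat}) : (D `<=` A)%fset ->
  modulus_sum x D <= modulus_sum x A.
Proof.
move=> DA; rewrite /modulus_sum (fsum_split A D) (fsetIidPr DA) lerDl.
exact: modulus_sum_ge0.
Qed.

Lemma le_modulus_sum x y (A : {fset nat}) :
  (forall i, i \in A -> modulus (x i) <= modulus (y i)) ->
  modulus_sum x A <= modulus_sum y A.
Proof.
by move=> xy; rewrite /modulus_sum big_seq [leRHS]big_seq; exact: ler_sum.
Qed.

(** This describes the closure of the finitely supported sequences, and can be
    stated before the norm is known to be finite. *)
Definition vanishing_tails (x : nat -> K) : Prop :=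
  forall eps : R, 0 < eps -> exists k, forall A, admissible phi A ->
    (forall i, i \in A -> (k <= i)%N) -> modulus_sum x A <= eps.

Definition schreier_pred : {pred (nat -> K^o)} :=
  fun x => `[< vanishing_tails x >].

Lemma schreier_submod : submod_closed schreier_pred.
Proof.
split=> [|c x y /asboolP xv /asboolP yv]; apply/asboolP => e e0.
  exists 0%N => A _ _; rewrite /modulus_sum big1 ?(ltW e0)// => i _.
  exact: modulus0.
have e2 : 0 < e / 2 by rewrite divr_gt0.
have c1 : 0 < modulus c + 1 by rewrite ltr_wpDl ?modulus_ge0.
have [k1 x1] := xv _ (divr_gt0 e2 c1); have [k2 y2] := yv _ e2.
exists (maxn k1 k2) => A adA Ak.
apply: (@le_trans _ _ (modulus c * modulus_sum x A + modulus_sum y A)).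
  rewrite /modulus_sum mulr_sumr -big_split/=; apply: ler_sum => i _.
  by rewrite (le_trans (modulusD _ _))// lerD2r modulusM.
rewrite (splitr e) lerD//; last first.
  by apply: y2 => // i /Ak; rewrite geq_max => /andP[].
have xA : modulus_sum x A <= e / 2 / (modulus c + 1).
  by apply: x1 => // i /Ak; rewrite geq_max => /andP[].
apply: le_trans (ler_wpM2l (modulus_ge0 c) xA) _.
rewrite mulrCA ler_piMr ?(ltW e2)//.
by rewrite ler_pdivrMr// mul1r lerDl.
Qed.

HB.instance Definition _ :=
  GRing.isSubmodClosed.Build K (nat -> K^o) schreier_pred schreier_submod.

Record schreier := Schreier {
  entry :> nat -> K^o;
  entry_vanishing : entry \in schreier_pred
}.

HB.instance Definition _ := [isSub for entry].
HB.instance Definition _ := [Choice of schreier by <:].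
HB.instance Definition _ := [SubChoice_isSubLmodule of schreier by <:].

End SchreierSpace.

Section SchreierNorm.
Variables (R : realType) (F : scalar_kind) (phi : nat -> nat).
Hypothesis phi_gt0 : forall n, (0 < phi n)%N.
Local Notation K := (scalar_field R F).
Local Notation X := (schreier R F phi).
Implicit Types (x y : X) (A : {fset nat}).

Definition snorm (x : X) : R := sup [set modulus_sum x A | A in admissible phi].

(** Removing the positions below [k] leaves an admissible set, so vanishing tails
    make all admissible sums of a sequence bounded. *)
Lemma modulus_sum_head_tail (x : nat -> K) k (t : R) A :
  (forall D, admissible phi D -> (forall i, i \in D -> (k <= i)%N) ->
     modulus_sum x D <= t) ->
  admissible phi A -> modulus_sum x A <= \sum_(i < k) modulus (x i) + t.
Proof.
move=> xt adA; pose H := [fset n in iota 0 k]%fset.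
rewrite /modulus_sum (fsum_split A H) lerD//.
  apply: le_trans (modulus_sum_sub x (fsubsetIr A H)) _.
  rewrite /modulus_sum big_imfset//= undup_id ?iota_uniq//.
  by rewrite -(big_mkord xpredT (fun i => modulus (x i))) /index_iota subn0.
apply: xt; first exact: admissible_sub (fsubsetDl _ _) adA.
by move=> i; rewrite !inE/= mem_iota add0n -leqNgt => /andP[].
Qed.

Lemma modulus_sum_bounded x : exists C, forall A, admissible phi A ->
  modulus_sum x A <= C.
Proof.
have /asboolP/(_ 1 ltr01)[k xk] := entry_vanishing x.
by exists (\sum_(i < k) modulus (x i) + 1) => A; exact: modulus_sum_head_tail.
Qed.

Lemma modulus_sum_le_snorm x A : admissible phi A -> modulus_sum x A <= snorm x.
Proof.
move=> adA; have [C xC] := modulus_sum_bounded x.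
by apply: ub_le_sup; [exists C => _ [D /xC + <-]|exists A].
Qed.

Lemma snorm_le x (C : R) :
  (forall A, admissible phi A -> modulus_sum x A <= C) -> snorm x <= C.
Proof.
move=> xC; apply: ge_sup; last by move=> _ [A /xC + <-].
by exists (modulus_sum x fset0); exists fset0 => //; exact: admissible0.
Qed.

Lemma modulus_entry_le x i : modulus (x i) <= snorm x.
Proof.
have := modulus_sum_le_snorm x (admissible1 (phi_gt0 i)).
by rewrite /modulus_sum big_seq_fset1.
Qed.

Lemma snorm_ge0 x : 0 <= snorm x.
Proof. exact: le_trans (modulus_ge0 _) (modulus_entry_le x 0). Qed.

Lemma snorm_definite x : snorm x = 0 -> x = 0.
Proof.
move=> x0; apply: val_inj; apply/funext => i; apply: modulus_eq0.
by apply/le_anti; rewrite modulus_ge0 andbT -x0 modulus_entry_le.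
Qed.

Lemma snormZ c x : snorm (c *: x) = modulus c * snorm x.
Proof.
have le (d : K) y : snorm (d *: y) <= modulus d * snorm y.
  apply: snorm_le => A adA.
  apply: le_trans (ler_wpM2l (modulus_ge0 d) (modulus_sum_le_snorm y adA)).
  by rewrite /modulus_sum mulr_sumr; apply: ler_sum => i _; rewrite -modulusM.
apply/le_anti; rewrite le/=; have [->|c0] := eqVneq c 0.
  by rewrite modulus0 mul0r snorm_ge0.
have c_gt0 : 0 < modulus c.
  rewrite lt_neqAle modulus_ge0 andbT eq_sym; apply: contra c0 => /eqP.
  by move=> /modulus_eq0 ->.
rewrite -ler_pdivlMl// -{1}(scalerK c0 x) (le_trans (le _ _))//.
rewrite ler_wpM2r ?snorm_ge0// -[leRHS]mul1r ler_pdivlMr//.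
by rewrite -modulusM mulVf// modulus1.
Qed.

Lemma snormD x y : snorm (x + y) <= snorm x + snorm y.
Proof.
apply: snorm_le => A adA.
apply: le_trans (lerD (modulus_sum_le_snorm x adA) (modulus_sum_le_snorm y adA)).
rewrite /modulus_sum -big_split/=; apply: ler_sum => i _; exact: modulusD.
Qed.

(** The limit is taken entrywise. Every admissible sum is finite, so a Cauchy
    estimate for it passes to the limit uniformly in the admissible set, and this
    uniformity also transfers vanishing tails to the limit. *)
Lemma snorm_complete (u : nat -> X) :
  cauchy_seq snorm u -> exists l, converges_to snorm u l.
Proof.
move=> uC.
have /choice[l ul] i : exists l : K, forall eps : R, 0 < eps ->
    exists M, forall n, (M <= n)%N -> modulus (u n i - l) < eps.
  apply: scalar_cauchy_converges => e /uC[M HM]; exists M => m n Mm Mn.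
  by apply: le_lt_trans (HM _ _ Mm Mn); exact: (modulus_entry_le (u m - u n)).
have close (e : R) : 0 < e -> exists M, forall m, (M <= m)%N -> forall A,
    admissible phi A -> modulus_sum (fun i => u m i - l i) A <= e.
  move=> e0; have [M HM] := uC _ e0; exists M => m Mm A adA.
  apply/ler_addgt0Pr => d d0; pose eta := d / (#|` A|.+1)%:R.
  have eta0 : 0 < eta by rewrite divr_gt0.
  have /choice[T HT] i : exists T, forall n, (T <= n)%N -> modulus (u n i - l i) < eta.
    exact: ul.
  pose n := maxn M (\max_(i <- A) T i).
  apply: (@le_trans _ _ (modulus_sum (u m - u n) A + modulus_sum (fun i => u n i - l i) A)).
    rewrite /modulus_sum -big_split/=; apply: ler_sum => i _.
    by rewrite -[u m i - l i](subrKA (u n i)) modulusD.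
  apply: lerD.
    apply: le_trans (modulus_sum_le_snorm _ adA) (ltW (HM _ _ Mm _)).
    exact: leq_maxl.
  apply: (@le_trans _ _ (\sum_(i <- A) eta)).
    rewrite /modulus_sum big_seq [leRHS]big_seq; apply: ler_sum => i iA.
    apply/ltW/HT; rewrite leq_max; apply/orP; right.
    exact: (@leq_bigmax_seq _ (enum_fset A) xpredT T).
  rewrite fsum_const /eta -[leLHS]mulr_natr mulrAC ler_pdivrMr// ler_pM2l//.
  by rewrite ler_nat.
have lv : l \in @schreier_pred R F phi.
  apply/asboolP => e e0; have e2 : 0 < e / 2 by rewrite divr_gt0.
  have [M HM] := close _ e2.
  have /asboolP/(_ _ e2)[k uk] := entry_vanishing (u M).
  exists k => A adA Ak; rewrite (splitr e).
  apply: le_trans (lerD (uk A adA Ak) (HM M (leqnn M) A adA)).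
  rewrite /modulus_sum -big_split/=; apply: ler_sum => i _.
  by rewrite -(modulusN (u M i - l i)) opprB -{1}(subrK (u M i) (l i)) addrC modulusD.
exists (Schreier lv); apply/cvgrPdist_le => e e0; have [M HM] := close _ e0.
exists M => // n /= Mn; rewrite sub0r normrN ger0_norm ?snorm_ge0//.
by apply: snorm_le => A adA; exact: (HM n Mn A adA).
Qed.

Lemma unit_vector_vanishing n : (fun i => (i == n)%:R) \in @schreier_pred R F phi.
Proof.
apply/asboolP => e e0; exists n.+1 => A _ An.
rewrite /modulus_sum big_seq big1 ?(ltW e0)// => i /An ni.
by rewrite gtn_eqF//= modulus0.
Qed.

Definition unit_vector n : X := Schreier (unit_vector_vanishing n).

Definition coordinate n (x : X) : K := x n.
Arguments coordinate : simpl never.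

Lemma coord_is_scalar n : scalar (coordinate n).
Proof. by []. Qed.

HB.instance Definition _ n := GRing.isLinear.Build K X K *%R (coordinate n) (coord_is_scalar n).

Lemma coord_unit_vector m n : coordinate m (unit_vector n) = (m == n)%:R.
Proof. by []. Qed.

Lemma coord_comb k (c : nat -> K) i :
  coordinate i (\sum_(n < k) c n *: unit_vector n) = if (i < k)%N then c i else 0.
Proof.
rewrite linear_sum/=; case: ifPn => ik.
  rewrite (bigD1 (Ordinal ik))//= linearZ/= coord_unit_vector eqxx mulr1.
  rewrite big1 ?addr0// => j ji; rewrite linearZ/= coord_unit_vector.
  have -> : (i == j :> nat) = false by rewrite eq_sym; exact: negPf ji.
  by rewrite mulr0.
rewrite big1// => j _; rewrite linearZ/= coord_unit_vector.
by rewrite gtn_eqF ?mulr0//; rewrite (leq_trans (ltn_ord j))// leqNgt.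
Qed.

(** Truncations converge; the coefficients of the truncation may moreover be
    perturbed slightly, which gives both density of the span and separability. *)
Lemma approx_by_truncation x (eps : R) : 0 < eps ->
  exists2 k, (0 < k)%N & forall c : nat -> K,
    (forall i, (i < k)%N -> modulus (x i - c i) <= eps / 2 / k%:R) ->
    snorm (x - \sum_(n < k) c n *: unit_vector n) <= eps.
Proof.
move=> e0; have e2 : 0 < eps / 2 by rewrite divr_gt0.
have /asboolP/(_ _ e2)[k xk] := entry_vanishing x.
exists k.+1 => // c xc; apply: snorm_le => A adA.
set y := x - _; have yE i : y i = if (i < k.+1)%N then x i - c i else x i.
  have -> : y i = x i - coordinate i (\sum_(n < k.+1) c n *: unit_vector n) by [].
  by rewrite coord_comb; case: ifP; rewrite ?subr0.
apply: le_trans (@modulus_sum_head_tail y k.+1 (eps / 2) A _ adA) _.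
  move=> D adD Dk; apply: le_trans (xk D adD _).
    by apply: le_modulus_sum => i /Dk ki; rewrite yE ltnNge ki.
  by move=> i /Dk /ltnW.
rewrite [leRHS]splitr lerD2r.
apply: (@le_trans _ _ (\sum_(i < k.+1) eps / 2 / k.+1%:R)).
  by apply: ler_sum => i _; rewrite yE ltn_ord xc.
by rewrite sumr_const card_ord -[leLHS]mulr_natr divfK// pnatr_eq0.
Qed.

Lemma unit_vectors_dense : dense_set snorm (linear_span unit_vector).
Proof.
move=> x e e0; have e2 : 0 < e / 2 by rewrite divr_gt0.
have [k k0 xk] := approx_by_truncation x e2.
exists (\sum_(n < k) x n *: unit_vector n); first by exists k, x.
apply: le_lt_trans (xk _ _) _; last by rewrite ltr_pdivrMr// ltr_pMr// ltrDl.
by move=> i _; rewrite subrr modulus0 !divr_ge0// ltW.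
Qed.

Lemma snorm_separable : separable_space snorm.
Proof.
have [d dd] := scalar_dense_enumeration R F.
pose f (s : seq (rat * rat)) : X :=
  \sum_(i < size s) d (nth (0, 0) s i) *: unit_vector i.
exists (range f); first exact: sub_countable (card_image_le _ _) (countableP _).
move=> x e e0; have e2 : 0 < e / 2 by rewrite divr_gt0.
have [k k0 xk] := approx_by_truncation x e2.
have eta0 : 0 < e / 2 / 2 / k%:R by rewrite !divr_gt0// ltr0n.
have /choice[q xq] i := dd (x i) _ eta0.
exists (f (mkseq q k)); first by exists (mkseq q k).
apply: (@le_lt_trans _ _ (e / 2)); last by rewrite ltr_pdivrMr// ltr_pMr// ltrDl.
rewrite /f size_mkseq.
apply: (xk (fun i => d (nth (0, 0) (mkseq q k) i))) => i ik.
by rewrite nth_mkseq//; apply/ltW/xq.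
Qed.

(** If [n] vectors spanned, the identity matrix of order [n + 1] would factor
    through dimension [n]. *)
Lemma schreier_infinite_dimensional : infinite_dimensional X.
Proof.
move=> n v; apply: contrapT => /forallNP nex.
have /choice[c cE] (i : 'I_n.+1) : exists c : 'I_n -> K,
    unit_vector i = \sum_(j < n) c j *: v j.
  by apply: contrapT => /forallNP nexi; apply: (nex (unit_vector i)).
pose P : 'M[K]_(n.+1, n) := \matrix_(i, j) c i j.
pose Q : 'M[K]_(n, n.+1) := \matrix_(j, i) coordinate i (v j).
suff : P *m Q = 1%:M by move=> /mulmx1_min; rewrite ltnn.
apply/matrixP => i j; rewrite !mxE.
transitivity (coordinate j (unit_vector i)).
  rewrite cE linear_sum/=; apply: eq_bigr => l _.
  by rewrite !mxE linearZ.
by rewrite coord_unit_vector eq_sym.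
Qed.

End SchreierNorm.

(** By concavity: each summand carries at least its proportion of the power of
    the sum. *)
Lemma powR_subadditive (R : realType) (p s t : R) : 0 < p -> p <= 1 ->
  0 <= s -> 0 <= t -> (s + t) `^ p <= s `^ p + t `^ p.
Proof.
move=> p0 p1 s0 t0; have [st0|st0] := eqVneq (s + t) 0.
  by rewrite st0 powR0 ?gt_eqF// addr_ge0// powR_ge0.
have st : 0 < s + t by rewrite lt_neqAle eq_sym st0 addr_ge0.
have part r : 0 <= r -> r <= s + t -> (s + t) `^ p * (r / (s + t)) <= r `^ p.
  move=> r0 rst; have [->|rn0] := eqVneq r 0; first by rewrite mul0r mulr0 powR_ge0.
  have rgt0 : 0 < r by rewrite lt_neqAle eq_sym rn0.
  rewrite -[X in _ <= X `^ p](divfK st0) [X in _ <= X `^ p]mulrC powRM ?divr_ge0 ?(ltW st)//.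
  rewrite ler_wpM2l ?powR_ge0// ger1_powR// divr_gt0//=.
  by rewrite ler_pdivrMr// mul1r.
apply: le_trans (lerD (part s s0 _) (part t t0 _)); last 2 first.
- by rewrite lerDl.
- by rewrite lerDr.
by rewrite -mulrDr -mulrDl divff// mulr1.
Qed.

Lemma exists_subset_card (E : {fset nat}) q : (q <= #|` E|)%N ->
  exists2 D : {fset nat}, (D `<=` E)%fset & #|` D| = q.
Proof.
move=> qE; exists [fset n in take q E]%fset.
  by apply/fsubsetP => n; rewrite !inE/= => /mem_take.
rewrite card_fseq undup_id ?take_uniq ?fset_uniq// size_take.
by move: qE; rewrite leq_eqVlt => /orP[/eqP->|->//]; rewrite ltnn.
Qed.

Lemma sum_le_of_card (R : realDomainType) (f : nat -> R) (D D' : {fset nat}) (c : nat) :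
  (forall i, 0 <= f i) -> (#|` D| <= c * #|` D'|)%N ->
  (forall i j, i \in D -> j \in D' -> f i <= f j) ->
  \sum_(i <- D) f i <= c%:R * \sum_(j <- D') f j.
Proof.
move=> f0 cDD' fDD'; have [D'0|D'0] := posnP #|` D'|.
  move: cDD'; rewrite D'0 muln0 leqn0 cardfs_eq0 => /eqP ->.
  by rewrite big_seq_fset0 mulr_ge0// sumr_ge0.
(* Averaging over [D']: both sides are compared with the double sum. *)
rewrite -(@ler_pM2r _ #|` D'|%:R) ?ltr0n//.
apply: (@le_trans _ _ (\sum_(i <- D) \sum_(j <- D') f j)).
  rewrite mulr_suml big_seq [leRHS]big_seq; apply: ler_sum => i iD.
  rewrite mulr_natr -fsum_const big_seq [leRHS]big_seq.
  by apply: ler_sum => j; exact: fDD'.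
rewrite fsum_const -[leLHS]mulr_natl mulrAC ler_wpM2r ?sumr_ge0//.
by rewrite -natrM ler_nat.
Qed.

(** * The unit vector basis *)

Section SchreierBasis.
Variables (R : realType) (F : scalar_kind) (p : R) (phi : nat -> nat).
Hypothesis p_gt0 : 0 < p.
Hypothesis p_le1 : p <= 1.
Hypothesis phi_gt0 : forall n, (0 < phi n)%N.
Local Notation K := (scalar_field R F).

(** A norm is a [p]-norm, so one Banach space serves for all [p]. *)
Lemma snorm_ptriangle (x y : schreier R F phi) :
  snorm (x + y) `^ p <= snorm x `^ p + snorm y `^ p.
Proof.
apply: le_trans (powR_subadditive p_gt0 p_le1 (snorm_ge0 phi_gt0 x) (snorm_ge0 phi_gt0 y)).
apply: ge0_ler_powR; rewrite ?nnegrE ?addr_ge0 ?snorm_ge0//; first exact: ltW.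
exact: snormD.
Qed.

Definition schreier_space : pBanach F p :=
  @PBanach R F p (schreier R F phi) (@snorm R F phi)
    (snorm_ge0 phi_gt0) (snorm_definite phi_gt0) (snormZ phi_gt0) snorm_ptriangle
    (@snorm_complete R F phi phi_gt0) (@snorm_separable R F phi)
    (@schreier_infinite_dimensional R F phi).

Local Notation X := schreier_space.

Definition coord_functional n : {scalar X} := @coordinate R F phi n.

Lemma snorm_unit_vector n : snorm (unit_vector R F phi n) = 1.
Proof.
apply/le_anti/andP; split.
  apply: snorm_le => A _; rewrite /modulus_sum.
  have [nA|nA] := boolP (n \in A).
    rewrite (big_fsetD1 n)//= eqxx modulus1 big_seq big1 ?addr0// => i.
    by rewrite !inE => /andP[/negPf -> _]; rewrite modulus0.
  rewrite big_seq big1// => i iA /=; have [E|_] := eqVneq i n; last by rewrite modulus0.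
  by rewrite E (negPf nA) in iA.
by have := modulus_entry_le phi_gt0 (unit_vector R F phi n) n; rewrite /= eqxx modulus1.
Qed.

Lemma dual_norm_coord n : dual_norm (coord_functional n) = 1%E.
Proof.
apply/le_anti/andP; split.
  apply: ge_ereal_sup => _ [x /= x1 <-]; rewrite lee_fin.
  exact: le_trans (modulus_entry_le phi_gt0 x n) x1.
apply: ereal_sup_ubound; exists (unit_vector R F phi n) => /=.
  by rewrite snorm_unit_vector.
by rewrite /coordinate /= eqxx modulus1.
Qed.

Lemma coord_functional_dual n : in_dual (coord_functional n).
Proof. by rewrite /in_dual dual_norm_coord ltry. Qed.

Lemma coord_biorthogonal : biorthogonal (unit_vector R F phi : nat -> X) coord_functional.
Proof. by []. Qed.

(** A bounded functional is determined by its values on the unit vectors, since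
    their span is dense. *)
Lemma coord_functional_unique (f : nat -> {scalar X}) :
  (forall n, in_dual (f n)) -> biorthogonal (unit_vector R F phi : nat -> X) f ->
  forall n, f n =1 coord_functional n.
Proof.
move=> fdual fe n x; apply/subr0_eq/modulus_eq0/le_anti.
rewrite modulus_ge0 andbT; apply/ler_addgt0Pr => e e0; rewrite add0r.
have [C C0 fC] : exists2 C, 0 <= C & (dual_norm (f n) <= C%:E)%E.
  have := fdual n; rewrite /in_dual; case: (dual_norm (f n)) => [r _|//|_].
    by exists `|r| => //; rewrite lee_fin ler_norm.
  by exists 0 => //; rewrite leNye.
have C1 : 0 < C + 1 by rewrite ltr_wpDl.
have [_ [N [c ->]] xy] := unit_vectors_dense x (divr_gt0 e0 C1).
set y : X := \sum_(i < N) _ in xy.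
have fy : f n y = coord_functional n y.
  rewrite !linear_sum; apply: eq_bigr => i _; rewrite !linearZ/=.
  by congr (_ * _); rewrite fe.
have -> : f n x - coord_functional n x = f n (x - y) - coord_functional n (x - y).
  by rewrite (linearB (f n)) (linearB (coord_functional n)) fy opprB addrA subrK.
apply: le_trans (modulusD _ _) _; rewrite modulusN.
apply: (@le_trans _ _ ((C + 1) * snorm (x - y))).
  rewrite mulrDl mul1r lerD//; first exact: (dual_norm_bound (X := X)).
  exact: modulus_entry_le.
by rewrite mulrC -ler_pdivlMr// ltW.
Qed.

Lemma schreier_norm_values v :
  norm_values (unit_vector R F phi : nat -> X) coord_functional v -> v = 1%E.
Proof.
case=> [[n _ <-]|[n _ <-]]; last exact: dual_norm_coord.
by rewrite /= snorm_unit_vector.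
Qed.

Lemma schreier_bounded_below :
  (0 < ereal_inf (norm_values (unit_vector R F phi : nat -> X) coord_functional))%E.
Proof.
apply: (@lt_le_trans _ _ 1%E); first exact: lte01.
by apply: le_ereal_inf_tmp => v /schreier_norm_values ->.
Qed.

Lemma schreier_bounded :
  (ereal_sup (norm_values (unit_vector R F phi : nat -> X) coord_functional) < +oo)%E.
Proof.
apply: (@le_lt_trans _ _ 1%E); last exact: ltry.
by apply: ge_ereal_sup => v /schreier_norm_values ->.
Qed.

Definition schreier_basis : pbasis X :=
  @PBasis R F p X (unit_vector R F phi) coord_functional
    (@unit_vectors_dense R F phi) coord_functional_dual coord_biorthogonal
    coord_functional_unique schreier_bounded_below schreier_bounded.

Local Notation B := schreier_basis.
Implicit Types (x : X) (A D L : {fset nat}).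

Lemma coefE x n : coef B n x = (x : schreier R F phi) n. Proof. by []. Qed.

Lemma residual_entry x A n :
  (x - coord_proj B A x : schreier R F phi) n =
  if n \in A then 0 else (x : schreier R F phi) n.
Proof.
rewrite -(coefE (x - coord_proj B A x)) linearB coef_coord_proj.
by case: ifP; rewrite ?subrr ?subr0.
Qed.

(** The norm only sees moduli, so replacing the competitor [A] by the greedy set
    [L] loses only the part of [x] on [A] outside [L]; it is charged to the larger
    entries on [L] outside [A]. *)
Lemma greedy_transfer x m L A (c : nat) : greedy_set B x m L ->
  (forall D, admissible phi D -> (D `<=` A `\` L)%fset ->
     exists D', [/\ admissible phi D', (D' `<=` L `\` A)%fset &
                    (#|` D| <= c * #|` D'|)%N]) ->
  qnorm (x - coord_proj B L x) <= c.+1%:R * qnorm (x - coord_proj B A x).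
Proof.
move=> [_ Lx] charge; apply: snorm_le => G adG.
pose D := (G `&` (A `\` L))%fset.
have adD : admissible phi D := admissible_sub (fsubsetIl _ _) adG.
have [D' [adD' D'LA cDD']] := charge D adD (fsubsetIr _ _).
rewrite /modulus_sum (fsum_split G (A `\` L)%fset) -/D.
rewrite -addn1 natrD mulrDl mul1r lerD//.
  apply: (@le_trans _ _ (c%:R * modulus_sum (x - coord_proj B A x : schreier R F phi) D')).
    rewrite /modulus_sum.
    have -> : \sum_(i <- D) modulus ((x - coord_proj B L x : schreier R F phi) i) =
              \sum_(i <- D) modulus ((x : schreier R F phi) i).
      rewrite big_seq [RHS]big_seq; apply: eq_bigr => i.
      by rewrite !in_fsetI !in_fsetD => /and3P[_ iL _]; rewrite residual_entry ifN.
    have -> : \sum_(i <- D') modulus ((x - coord_proj B A x : schreier R F phi) i) =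
              \sum_(i <- D') modulus ((x : schreier R F phi) i).
      rewrite big_seq [RHS]big_seq; apply: eq_bigr => i /(fsubsetP D'LA).
      by rewrite in_fsetD => /andP[iA _]; rewrite residual_entry ifN.
    apply: (sum_le_of_card (f := fun i => modulus ((x : schreier R F phi) i))) => //.
      by move=> i; exact: modulus_ge0.
    move=> i j; rewrite in_fsetI in_fsetD => /and3P[_ iL _].
    by move=> /(fsubsetP D'LA); rewrite in_fsetD => /andP[_ jL]; exact: Lx.
  by rewrite ler_wpM2l// modulus_sum_le_snorm.
have adGD : admissible phi (G `\` (A `\` L))%fset := admissible_sub (fsubsetDl _ _) adG.
apply: le_trans (modulus_sum_le_snorm (x - coord_proj B A x : schreier R F phi) adGD).
apply: le_modulus_sum => i; rewrite !in_fsetD negb_and negbK => /andP[iLA _].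
rewrite !residual_entry; case: ifPn => [_|iL]; first by rewrite modulus0 modulus_ge0.
by rewrite ifN//; move: iLA; rewrite (negPf iL).
Qed.

Hypothesis phi_mono : forall m n, (m <= n)%N -> (phi m <= phi n)%N.

(** For every nondecreasing gauge a greedy set dominates initial segments: it has at
    least as many positions beyond [k] as it misses below [k], and positions
    further to the right are subject to weaker restrictions. *)
Lemma schreier_strong_partially_greedy : strong_partially_greedy B.
Proof.
exists 2 => // x m L m0 Lx; apply/le_mul_infP => //.
- by exists 0%N.
- by move=> A; exact: qnorm_ge0.
move=> k km; rewrite partial_sumE.
apply: (greedy_transfer (c := 1) Lx) => D adD DKL.
set K' := [fset n in iota 0 k]%fset in DKL *.
have inK n : (n \in K') = (n < k)%N by rewrite !inE/= mem_iota.
have [|D' D'LK cD'] := @exists_subset_card (L `\` K')%fset #|` D|.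
  exact: leq_trans (fsubset_leq_card DKL) (card_head_le_tail Lx km).
exists D'; split=> //; last by rewrite mul1n cD'.
move=> i iD'; have [D0|D0] := posnP #|` D|; first by rewrite cD' D0.
have [d dD] : exists d, d \in D by apply/fset0Pn; rewrite -cardfs_gt0.
rewrite cD' (leq_trans (adD d dD))// phi_mono//.
have : (d < k)%N by move: (fsubsetP DKL d dD); rewrite in_fsetD inK => /andP[].
have : (k <= i)%N.
  by move: (fsubsetP D'LK i iD'); rewrite in_fsetD inK -leqNgt => /andP[].
by move=> ki dk; exact: leq_trans (ltnW dk) ki.
Qed.

Definition indicator (S : {fset nat}) : X := \sum_(n <- S) 1 *: B n.

Lemma indicator_entry S n : (indicator S : schreier R F phi) n = if n \in S then 1 else 0.
Proof. exact: (coef_fsum B S (fun=> 1)). Qed.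

(** On an indicator every subset of the support is a greedy set, and the error
    is the norm of the indicator of what is left. *)
Lemma indicator_residuals (S L A D : {fset nat}) n :
  (L `<=` S)%fset -> (D `<=` S `\` L)%fset -> admissible phi D ->
  (forall i, i \in (S `\` A)%fset -> (i <= n)%N) ->
  [/\ greedy_set B (indicator S) #|` L| L,
      #|` D|%:R <= qnorm (indicator S - coord_proj B L (indicator S)) &
      qnorm (indicator S - coord_proj B A (indicator S)) <= (phi n)%:R].
Proof.
move=> LS DSL adD SAn; split.
- split=> // i j /(fsubsetP LS) iS _; rewrite !coefE !indicator_entry iS modulus1.
  by case: ifP; rewrite ?modulus1 ?modulus0.
- apply: le_trans (modulus_sum_le_snorm (indicator S - coord_proj B L (indicator S)
    : schreier R F phi) adD).
  rewrite -fsum_const /modulus_sum big_seq [leRHS]big_seq; apply: ler_sum => i.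
  move=> /(fsubsetP DSL); rewrite in_fsetD => /andP[iL iS].
  by rewrite residual_entry ifN// indicator_entry iS modulus1.
- apply: snorm_le => G adG; rewrite /modulus_sum (fsum_split G (S `\` A)%fset).
  rewrite [X in _ + X]big_seq [X in _ + X]big1 ?addr0; last first.
    move=> i; rewrite !in_fsetD negb_and negbK => /andP[iSA _].
    rewrite residual_entry; case: ifPn => [_|iA]; first exact: modulus0.
    by rewrite indicator_entry ifN ?modulus0//; move: iSA; rewrite (negPf iA).
  set G' := (G `&` _)%fset; apply: (@le_trans _ _ #|` G'|%:R).
    rewrite -fsum_const big_seq [leRHS]big_seq; apply: ler_sum => i _.
    rewrite residual_entry indicator_entry.
    by case: ifP; rewrite ?modulus0//; case: ifP; rewrite ?modulus0 ?modulus1.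
  rewrite ler_nat; have [->//|G'0] := posnP #|` G'|.
  have [g gG'] : exists g, g \in G' by apply/fset0Pn; rewrite -cardfs_gt0.
  have /andP[gG gSA] : (g \in G) && (g \in (S `\` A)%fset) by rewrite -in_fsetI.
  apply: leq_trans (phi_mono (SAn g gSA)).
  exact: leq_trans (fsubset_leq_card (fsubsetIl _ _)) (adG g gG).
Qed.

End SchreierBasis.

(** * Charging admissible sets to gaps *)

Section GapCharging.
Variable a : nat -> nat.
Hypothesis a_gt0 : forall n, (0 < a n)%N.
Variable phi : nat -> nat.
Hypothesis phi_mono : forall m n, (m <= n)%N -> (phi m <= phi n)%N.
Hypothesis phi_ge_gaps : forall n, (gap_count a n <= phi n)%N.
Local Open Scope nat_scope.

(** If up to every position [E] is no denser than the gaps, then its [r]-th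
    element is at a position preceded by [r] gaps, so the upper half of [E] is
    admissible. *)
Lemma admissible_upper_half (E : {fset nat}) :
  (forall n, #|` [fset e in E | e <= n]%fset| <= gap_count a n) ->
  exists D, [/\ admissible phi D, (D `<=` E)%fset & #|` E| <= 2 * #|` D|].
Proof.
move=> Esparse; have [E0|E0] := posnP #|` E|.
  by exists fset0; split; [exact: admissible0|exact: fsub0set|rewrite E0].
pose low n := [fset e in E | e <= n]%fset.
have ex : exists n, #|` E| <= 2 * #|` low n|.
  have [N EN] := fset_nat_bound E; exists N.
  have -> : low N = E.
    apply/fsetP => e; rewrite !inE/=; case: (boolP (e \in E)) => //= /EN.
    exact: ltnW.
  by rewrite leq_pmull.
case: (ex_minnP ex) => n nE nmin.
pose high := [fset e in E | n <= e]%fset.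
have lowhigh : #|` E| < 2 * #|` high|.
  have cE : #|` E| <= #|` [fset e in E | e < n]%fset| + #|` high|.
    rewrite (leq_trans _ (_ : #|` ([fset e in E | e < n] `|` high)%fset| <= _))//.
      apply: fsubset_leq_card; apply/fsubsetP => e eE; rewrite !inE/= eE/=.
      by case: leqP; rewrite ?orbT.
    by rewrite cardfsU leq_subr.
  suff : 2 * #|` [fset e in E | e < n]%fset| < #|` E| by lia.
  case: n nmin {nE high cE} => [_|n nmin].
    have -> : [fset e in E | e < 0]%fset = fset0.
      by apply/fsetP => e; rewrite !inE/= ltn0 andbF.
    by rewrite cardfs0.
  by rewrite ltnNge; apply/negP => /nmin; rewrite ltnn.
have [|D Dhigh cD] := @exists_subset_card high (uphalf #|` E|).
  by rewrite leq_uphalf_double -mul2n ltnW.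
have DE : (D `<=` E)%fset.
  by apply: fsubset_trans Dhigh _; apply/fsubsetP => e; rewrite !inE/= => /andP[].
exists D; split=> //; last first.
  by rewrite cD mul2n -leq_uphalf_double.
move=> i iD; have ni : n <= i.
  by move: (fsubsetP Dhigh i iD); rewrite !inE/= => /andP[].
rewrite cD; apply: leq_trans (phi_mono ni); apply: leq_trans (phi_ge_gaps n).
by apply: leq_trans (Esparse n); rewrite leq_uphalf_double -mul2n.
Qed.

(** A set [E] that avoids [shifted_sums a k l] and starts after its minimum
    splits into a part beyond the maximum, which competes with any admissible [D]
    inside the shifted sums, and a part inside the gaps, to which
    [admissible_upper_half] applies. *)
Lemma charge_to_complement (k l : nat) (E D : {fset nat}) :
  0 < l -> (forall e, e \in E -> k + psum a 0 <= e) ->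
  (forall e, e \in E -> e \notin shifted_sums a k l) ->
  admissible phi D -> (D `<=` shifted_sums a k l)%fset -> #|` D| <= #|` E| ->
  exists D', [/\ admissible phi D', (D' `<=` E)%fset & #|` D| <= 4 * #|` D'|].
Proof.
move=> l0 Emin Eshift adD Dshift DE.
pose top := k + psum a l.-1.
pose E1 := [fset e in E | e <= top]%fset; pose E2 := [fset e in E | top < e]%fset.
have E1E : (E1 `<=` E)%fset by apply/fsubsetP => e; rewrite !inE/= => /andP[].
have E2E : (E2 `<=` E)%fset by apply/fsubsetP => e; rewrite !inE/= => /andP[].
have cE : #|` E| <= #|` E1| + #|` E2|.
  rewrite (leq_trans _ (_ : #|` (E1 `|` E2)%fset| <= _))//.
    apply: fsubset_leq_card; apply/fsubsetP => e eE; rewrite !inE/= eE/=.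
    by case: leqP; rewrite ?orbT.
  by rewrite cardfsU leq_subr.
have [E12|E12] := leqP #|` E1| #|` E2|.
  have [|D' D'E2 cD'] := @exists_subset_card E2 (minn #|` D| #|` E2|).
    exact: geq_minr.
  exists D'; split; last by rewrite cD'; lia.
    move=> i iD'; have [D0|D0] := posnP #|` D|; first by rewrite cD' D0 min0n.
    have [d dD] : exists d, d \in D by apply/fset0Pn; rewrite -cardfs_gt0.
    have dtop : d <= top.
      have /(mem_shifted_sums a_gt0)[j jl ->] := fsubsetP Dshift d dD.
      by rewrite leq_add2l psum_le//; lia.
    have topi : top < i by move: (fsubsetP D'E2 i iD'); rewrite !inE/= => /andP[].
    rewrite cD'; apply: leq_trans (geq_minl _ _) _.
    exact: leq_trans (adD d dD) (phi_mono (leq_trans dtop (ltnW topi))).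
  exact: fsubset_trans D'E2 E2E.
have E1gap e : e \in E1 -> (k <= e) && gap a (e - k).
  rewrite !inE/= => /andP[eE etop].
  have ke : k <= e by rewrite (leq_trans _ (Emin e eE))// leq_addr.
  have notin j : j < l -> e <> k + psum a j.
    move=> jl E'; have /negP := Eshift e eE; apply.
    by apply/(mem_shifted_sums a_gt0); exists j.
  have e0 := Emin e eE.
  have [i i1 i2] := psum_bracket a_gt0 (n := e - k) ltac:(lia).
  rewrite ke/=; have il : i < l.
    rewrite -(prednK l0) ltnS -(psum_le a_gt0) (leq_trans i1)//.
    by rewrite leq_subLR.
  apply: (gap_between a_gt0 _ i2).
  by rewrite ltn_neqAle i1 andbT; apply/eqP => ei; apply: (notin i il); lia.
have [D' [adD' D'E1 cD']] : exists D',
    [/\ admissible phi D', (D' `<=` E1)%fset & #|` E1| <= 2 * #|` D'|].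
  apply: admissible_upper_half => n.
  have inlow e : e \in [fset e in E1 | e <= n]%fset -> e \in E1 /\ e <= n.
    by rewrite !inE/= => /andP.
  rewrite /gap_count -size_filter -[leqLHS](size_map (fun e => e - k)).
  apply: uniq_leq_size.
    rewrite map_inj_in_uniq ?fset_uniq// => e e' /inlow[eE1 _] /inlow[e'E1 _].
    have /andP[ke _] := E1gap e eE1; have /andP[ke' _] := E1gap e' e'E1; lia.
  move=> _ /mapP[e /inlow[eE1 en] ->].
  have /andP[ke ge] := E1gap e eE1.
  by rewrite mem_filter ge mem_iota/=; lia.
exists D'; split=> //; first exact: fsubset_trans D'E1 E1E.
lia.
Qed.

End GapCharging.

Lemma trunc_log_sublinear (C : nat) : exists h, forall n, (2 ^ h <= n)%N ->
  (C * (trunc_log 2 n).+1 < n)%N.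
Proof.
(* With [s] half of [t], the factor [t.+1] is at most [2 * 2 ^ s] and [2 ^ t] is at
   least [2 ^ s * 2 ^ s], so it suffices that [2 * C < 2 ^ s]. *)
exists (4 * C)%N => n hn; set t := trunc_log 2 n.
have n0 : (0 < n)%N by rewrite (leq_trans _ hn)// expn_gt0.
have tn : (2 ^ t <= n)%N by apply: trunc_logP.
have Ct : (4 * C <= t)%N by apply: trunc_log_max.
apply: leq_trans tn.
have Cs : (2 * C < 2 ^ t./2)%N.
  by apply: leq_ltn_trans (ltn_expl _ _) => //; lia.
have ts : (t.+1 <= 2 * 2 ^ t./2)%N.
  by have := ltn_expl t./2 (isT : 1 < 2)%N; lia.
have : (2 ^ t./2 * 2 ^ t./2 <= 2 ^ t)%N.
  by rewrite -expnD leq_pexp2l//; lia.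
nia.
Qed.

(** * The separating bases *)

Lemma card_sub_swap (A L : {fset nat}) : (#|` A| <= #|` L|)%N ->
  (#|` (A `\` L)%fset| <= #|` (L `\` A)%fset|)%N.
Proof.
by rewrite -(cardfsID L A) -(cardfsID A L) (fsetIC L A) leq_add2l.
Qed.

Lemma infinite_set_unbounded (P : set nat) : infinite_set P ->
  forall N, exists2 n, (N <= n)%N & P n.
Proof.
move=> Pinf N; apply: contrapT => nex; apply: Pinf.
apply: (sub_finite_set _ (finite_II N)) => n Pn /=.
by rewrite ltnNge; apply/negP => Nn; apply: nex; exists n.
Qed.

Section Examples.
Variables (R : realType) (F : scalar_kind) (p : R).
Hypothesis p_gt0 : 0 < p.
Hypothesis p_le1 : p <= 1.
Variable phi : nat -> nat.
Hypothesis phi_gt0 : forall n, (0 < phi n)%N.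
Hypothesis phi_mono : forall m n, (m <= n)%N -> (phi m <= phi n)%N.

Local Notation B := (schreier_basis F p_gt0 p_le1 phi_gt0).

(** A set of greedy positions that avoids a shift of the partial sums either lies
    largely beyond it, where the admissibility condition is weaker, or is no
    denser than the gaps; a gauge that dominates the gap count makes half of it
    admissible in the second case. *)
Lemma schreier_minimum_partially_greedy (a : nat -> nat) :
  (forall n, (0 < a n)%N) -> (forall n, (gap_count a n <= phi n)%N) ->
  minimum_partially_greedy B (seq_family a).
Proof.
move=> a_gt0 phi_gaps.
(* [charge_to_complement] costs a factor 4, the common part of the two
   residuals a further 1. *)
exists 5; first by rewrite ler1n.
move=> x m L m0 Lx; apply/le_mul_infP => //.
- exact/admissible_competitors0/fset0_in_seq_family.
- by move=> A; exact: qnorm_ge0.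
move=> A [FA Am minA]; apply: (greedy_transfer (c := 4) Lx) => D adD DAL.
have [A0|A0] := eqVneq A fset0.
  exists fset0; split; [exact: admissible0|exact: fsub0set|].
  by move: DAL; rewrite A0 fset0D fsubset0 => /eqP ->; rewrite cardfs0.
case: FA A0 => [->|[k [l [l0 AE]]] _]; first by rewrite eqxx.
have [A0|[i [iA imin] iL]] := minA.
  by have := card_shifted_sums a_gt0 k l; rewrite -AE A0 cardfs0; lia.
have DA : (D `<=` shifted_sums a k l)%fset.
  by rewrite -AE; apply: fsubset_trans DAL (fsubsetDl _ _).
apply: (charge_to_complement a_gt0 phi_mono phi_gaps l0 _ _ adD DA).
- move=> e; rewrite in_fsetD => /andP[_ /iL]; apply: leq_trans.
  move: iA; rewrite AE => /(mem_shifted_sums a_gt0)[j _ ->].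
  by rewrite leq_add2l psum_le.
- by move=> e; rewrite in_fsetD -AE => /andP[].
- case: Lx => cL _; apply: leq_trans (fsubset_leq_card DAL) (card_sub_swap _).
  by rewrite cL.
Qed.

Hypothesis phi_unbounded : forall q, exists N, (q <= phi N)%N.

(** An initial segment of length [n] has norm at most [phi n], much less than [n],
    whereas a distant set of the same size has norm [n]. *)
Lemma schreier_not_almost_greedy :
  (forall C, exists n, (C * phi n < n)%N) -> ~ almost_greedy B.
Proof.
move=> sublinear [C C0 AG].
have [C' CC'] : exists C' : nat, C <= C'%:R.
  by exists (Num.truncn C).+1; apply/ltW/truncnS_gt.
have [n nC] := sublinear C'; have [N nN] := phi_unbounded n.
pose L := [fset i in iota 0 n]%fset.
pose A := [fset i in iota (maxn n N) n]%fset.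
have cL : #|` L| = n by rewrite card_fseq undup_id ?iota_uniq// size_iota.
have cA : #|` A| = n by rewrite card_fseq undup_id ?iota_uniq// size_iota.
have inL i : (i \in L) = (i < n)%N by rewrite !inE/= mem_iota.
have inA i : i \in A -> (n <= i)%N /\ (N <= i)%N.
  by rewrite !inE/= mem_iota geq_max => /andP[/andP[]].
have adA : admissible phi A.
  by move=> i /inA[_ Ni]; rewrite cA (leq_trans nN)// phi_mono.
have [|||i|] := @indicator_residuals R F p phi p_gt0 p_le1 phi_gt0 phi_mono
  (L `|` A)%fset L A A n.
- exact: fsubsetUl.
- apply/fsubsetP => i iA; rewrite in_fsetD in_fsetU iA orbT andbT inL -leqNgt.
  by have [] := inA i iA.
- exact: adA.
- rewrite in_fsetD in_fsetU => /andP[iA]; rewrite (negPf iA) orbF inL.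
  exact: ltnW.
set x := indicator _ _ _ _ _; move=> Lx lower upper.
rewrite cL in Lx; rewrite cA in lower.
have n0 : (0 < n)%N by case: (n) nC.
have := AG x n L n0 Lx; move/le_mul_infP => /(_ C0 (ex_intro _ _ cA) (fun=> qnorm_ge0 _) _ cA).
apply/negP; rewrite -ltNge; apply: lt_le_trans lower.
apply: (@le_lt_trans _ _ (C'%:R * (phi n)%:R)).
  by rewrite ler_pM ?qnorm_ge0// ltW.
by rewrite -natrM ltr_nat.
Qed.

(** The gaps up to [n] are numerous compared with [phi n], so that their indicator
    is small compared with that of equally many distant partial sums. *)
Lemma schreier_not_minimum_partially_greedy (a : nat -> nat) :
  (forall n, (0 < a n)%N) ->
  (forall C, exists n, (C * phi n < gap_count a n)%N) ->
  ~ minimum_partially_greedy B (seq_family a).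
Proof.
move=> a_gt0 superlinear [C C1 mpg].
have C0 : 0 < C := lt_le_trans ltr01 C1.
have [C' CC'] : exists C' : nat, C <= C'%:R.
  by exists (Num.truncn C).+1; apply/ltW/truncnS_gt.
have [n nC] := superlinear C'; set q := gap_count a n in nC.
have [N qN] := phi_unbounded q.
pose E := [fset i in [seq i <- iota 0 n.+1 | gap a i]]%fset.
have cE : #|` E| = q.
  by rewrite card_fseq undup_id ?filter_uniq ?iota_uniq// size_filter.
have inE' i : (i \in E) = (gap a i && (i <= n)%N).
  by rewrite in_fset [LHS]mem_filter mem_iota.
pose A := shifted_sums a 0 (N + q); pose A0 := shifted_sums a 0 N.
have A0A : (A0 `<=` A)%fset.
  apply/fsubsetP => i /(mem_shifted_sums a_gt0)[j jN ->].
  by apply/(mem_shifted_sums a_gt0); exists j => //; rewrite ltn_addr.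
pose D := (A `\` A0)%fset.
have cD : #|` D| = q.
  by rewrite cardfsDS// !card_shifted_sums// addKn.
have EA i : i \in E -> i \notin A.
  rewrite inE' => /andP[/asboolP[_ gi] _]; apply/negP.
  by move=> /(mem_shifted_sums a_gt0)[j _ ij]; apply: (gi j); rewrite ij.
pose L := (E `|` A0)%fset.
have cL : #|` L| = (q + N)%N.
  rewrite card_fsetU_disjoint ?cE ?card_shifted_sums//.
  apply/fdisjointP => i /EA; apply: contra; exact: (fsubsetP A0A).
have adD : admissible phi D.
  move=> i; rewrite in_fsetD cD => /andP[iA0 /(mem_shifted_sums a_gt0)[j _ ij]].
  rewrite (leq_trans qN)// phi_mono// ij add0n.
  apply: leq_trans (psum_ge a_gt0 j); rewrite leqNgt; apply: contra iA0 => jN.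
  by apply/(mem_shifted_sums a_gt0); exists j.
have [|||i|] := @indicator_residuals R F p phi p_gt0 p_le1 phi_gt0 phi_mono
  (E `|` A)%fset L A D n.
- exact: fsetUS.
- apply/fsubsetP => i; rewrite !in_fsetD !in_fsetU => /andP[iA0 iA].
  rewrite iA orbT andbT negb_or iA0 andbT.
  by apply: contraL iA => /EA.
- exact: adD.
- rewrite in_fsetD in_fsetU => /andP[iA]; rewrite (negPf iA) orbF inE'.
  by case/andP.
set x := indicator _ _ _ _ _; move=> Lx lower upper.
rewrite cD in lower.
have q0 : (0 < q)%N by case: (q) nC.
have L0 : (0 < #|` L|)%N by rewrite cL addn_gt0 q0.
have FA : [/\ seq_family a A, (#|` A| <= #|` L|)%N & min_before A L].
  split; first by right; exists 0%N, (N + q)%N; rewrite addn_gt0 q0 orbT.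
    by rewrite cL card_shifted_sums// addnC.
  right; exists (psum a 0); first split.
  - by apply/(mem_shifted_sums a_gt0); exists 0%N; [rewrite addn_gt0 q0 orbT|rewrite add0n].
  - by move=> j /(mem_shifted_sums a_gt0)[i _ ->]; rewrite psum_le.
  - move=> i; rewrite in_fsetU inE' => /orP[/andP[/asboolP[/ltnW//]]|].
    by move=> /(mem_shifted_sums a_gt0)[j _ ->]; rewrite psum_le.
have := mpg x #|` L| L L0 Lx.
move/le_mul_infP => /(_ C0 (ex_intro _ _ FA) (fun=> qnorm_ge0 _) _ FA).
apply/negP; rewrite -ltNge; apply: lt_le_trans lower.
apply: (@le_lt_trans _ _ (C'%:R * (phi n)%:R)).
  by rewrite ler_pM ?qnorm_ge0// ltW.
by rewrite -natrM ltr_nat.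
Qed.

End Examples.

Theorem theorem2p7 (R : realType) (F : scalar_kind) (p : R)
    (p_gt0 : 0 < p) (p_le1 : p <= 1)
    (a : nat -> nat) (a_gt0 : forall n, (0 < a n)%N)
    (a_bounded : exists M : nat, forall n, (a n <= M)%N)
    (a_sparse : exists2 alpha : R, 0 < alpha &
       forall m : nat, (0 < m)%N ->
         #|[pred n : 'I_m | (2 <= a n)%N]|%:R <= alpha * m%:R `^ (4%:R^-1))
    (a_infinite : infinite_set [set n : nat | (2 <= a n)%N]) :
  [/\ forall (X : pBanach F p) (B : pbasis X),
        almost_greedy B -> minimum_partially_greedy B (seq_family a),
      forall (X : pBanach F p) (B : pbasis X),
        minimum_partially_greedy B (seq_family a) -> strong_partially_greedy B,
      exists (X : pBanach F p) (B : pbasis X),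
        minimum_partially_greedy B (seq_family a) /\ ~ almost_greedy B
    & exists (X : pBanach F p) (B : pbasis X),
        strong_partially_greedy B /\
        ~ minimum_partially_greedy B (seq_family a)].
Proof.
have [M aM] := a_bounded; have [alpha _ sparse] := a_sparse.
have unbounded := gap_count_unbounded a_gt0 (infinite_set_unbounded a_infinite).
split.
- by move=> X B; apply: almost_greedy_minimum_partially_greedy => //; exact: fset0_in_seq_family.
- move=> X B; apply: (minimum_partially_greedy_of_cover p_gt0 (M := M) (N0 := psum a 0)).
    exact: fset0_in_seq_family.
  exact: seq_family_cover.
- pose phi n := (gap_count a n).+1.
  have phi_gt0 n : (0 < phi n)%N by [].
  have phi_mono m n : (m <= n)%N -> (phi m <= phi n)%N.
    by move=> mn; rewrite ltnS gap_count_mono.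
  exists (schreier_space F p_gt0 p_le1 phi_gt0), (schreier_basis F p_gt0 p_le1 phi_gt0).
  split; first by apply: schreier_minimum_partially_greedy.
  apply: schreier_not_almost_greedy => //; last exact: gap_count_sublinear sparse.
  by move=> q; have [n qn] := unbounded q; exists n; rewrite leqW.
- pose phi n := (trunc_log 2 (gap_count a n)).+1.
  have phi_gt0 n : (0 < phi n)%N by [].
  have phi_mono m n : (m <= n)%N -> (phi m <= phi n)%N.
    by move=> mn; rewrite ltnS leq_trunc_log// gap_count_mono.
  exists (schreier_space F p_gt0 p_le1 phi_gt0), (schreier_basis F p_gt0 p_le1 phi_gt0).
  split; first exact: schreier_strong_partially_greedy.
  apply: schreier_not_minimum_partially_greedy => //.
    move=> q; have [n qn] := unbounded (2 ^ q)%N.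
    by exists n; rewrite leqW// trunc_log_max.
  move=> C; have [h hC] := trunc_log_sublinear C; have [n hn] := unbounded (2 ^ h)%N.
  by exists n; exact: hC.
Qed.
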